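(* Let $M$ be a connected Riemann surface and let $\varphi:M\to G_k(\mathbb{C}^n)$ be a harmonic map of finite uniton number and finite isotropy order, with first return map $\mathbf{c}$ of nilorder $2$ and second return map $\mathbf{e}$. Let $\alpha$ be any subbundle of $\varphi$ with $\operatorname{Im}\mathbf{c}\subseteq\alpha\subseteq\ker\mathbf{c}$. For $s=1,2,\ldots$, let $\mathbf{D}_s$ be the bundle map $\mathbf{c}\circ\mathbf{e}^s|_\alpha:\alpha\to\alpha$. Suppose that for some $s\ge1$, $$\mathbf{D}_t=0\ \text{ on }\alpha,\quad\text{for } 1\le t<s.$$ Then $\mathbf{D}_s:\alpha\to\alpha$ is nilpotent.
   Context: $M$ is a connected Riemann surface (not necessarily compact), $z$ a local complex coordinate, $\partial_z,\partial_{\bar z}$ the ordinary (flat) derivatives in $\mathbb{C}^n$. A smooth map $\varphi:M\to G_k(\mathbb{C}^n)$ is identified with the rank-$k$ subbundle of $M\times\mathbb{C}^n$ with fibre $\varphi(z)$ at $z$. $\pi_\psi$ is orthogonal projection onto $\psi$, $\psi^\perp$ the orthogonal complement, $\Gamma(\cdot)$ the smooth sections. For mutually orthogonal subbundles $\psi,\chi$, the second fundamental form is $A'_{\psi,\chi}=\pi_\chi\circ\partial_z|_\psi:\psi\to\chi$ (a bundle map); $A'_\psi=A'_{\psi,\psi^\perp}$. Images and kernels of bundle maps are understood as extended to subbundles over the isolated points where the rank drops (''filling out zeros''). For $\varphi$ harmonic, $G'(\varphi)=\operatorname{Im}A'_\varphi$, $G^{(0)}(\varphi)=\varphi$, $G^{(i+1)}(\varphi)=G'(G^{(i)}(\varphi))$.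 The isotropy order of $\varphi$ is the greatest $r\in\{1,2,\ldots,\infty\}$ such that $\varphi\perp G^{(i)}(\varphi)$ for all $1\le i\le r$; then $G^{(i)}(\varphi)\perp G^{(j)}(\varphi)$ whenever $1\le|i-j|\le r$. For $\varphi$ of finite isotropy order $r$, put $R=\bigl(\sum_{i=0}^rG^{(i)}(\varphi)\bigr)^\perp$. The first return map is the bundle map $\varphi\to\varphi$ $$\mathbf{c}=A'_{G^{(r)}(\varphi),\varphi}\circ A'_{G^{(r-1)}(\varphi)}\circ\cdots\circ A'_{G^{(1)}(\varphi)}\circ A'_\varphi,$$ and the second return map is the bundle map $\varphi\to\varphi$ $$\mathbf{e}=A'_{R,\varphi}\circ A'_{G^{(r)}(\varphi),R}\circ A'_{G^{(r-1)}(\varphi)}\circ\cdots\circ A'_{G^{(1)}(\varphi)}\circ A'_\varphi .$$ These are defined on each coordinate chart; a change of coordinate multiplies them by nowhere-zero functions. The nilorder of $\mathbf{c}$ is the least $p$ with $\mathbf{c}^p=0$. Finite uniton number: for smooth $\varphi:M\to U(n)$ put $A^\varphi_z=\frac12\varphi^{-1}\partial_z\varphi$, $A^\varphi_{\bar z}=\frac12\varphi^{-1}\partial_{\bar z}\varphi$. A uniton for a harmonic $\varphi:M\to U(n)$ is a subbundle $\alpha$ of $M\times\mathbb{C}^n$ with $\Gamma(\alpha)$ closed under $\partial_{\bar z}+A^\varphi_{\bar z}$ and under $A^\varphi_z$. $\varphi$ is of finite uniton number if $\varphi=\varphi_0(\pi_{\alpha_1}-\pi_{\alpha_1}^\perp)\cdots(\pi_{\alpha_s}-\pi_{\alpha_s}^\perp)$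 for some $s\ge0$, with $\varphi_0\in U(n)$ constant and each $\alpha_i$ a uniton for the partial product of the first $i-1$ factors (times $\varphi_0$). A map $\varphi:M\to G_k(\mathbb{C}^n)$ is of finite uniton number if $\pi_\varphi-\pi_\varphi^\perp:M\to U(n)$ is. *)

(* Defs.v *)
From HB Require Import structures.
From mathcomp Require Export all_boot all_order all_algebra.
From mathcomp Require Export complex.
From mathcomp Require Import ring.
From mathcomp Require Export all_classical all_reals all_analysis.

Set Implicit Arguments.
Unset Strict Implicit.
Unset Printing Implicit Defensive.

Export Order.TTheory GRing.Theory Num.Theory.
Export numFieldNormedType.Exports.

Global Open Scope classical_set_scope.
Global Open Scope ring_scope.
Global Open Scope complex_scope.
Global Open Scope sesquilinear_scope.

(* Derivatives of f : C -> C with respect to the real variables x, y, where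
   z = x + iy; [pderiv 1] is d/dx and [pderiv 'i] is d/dy. *)
Section PlaneCalculus.
Variable R : realType.
Implicit Types (f : R[i] -> R[i]) (v z : R[i]).

Definition pderivable v f z : Prop :=
  derivable (fun t : R => complex.Re (f (z + t%:C * v))) 0 1 /\
  derivable (fun t : R => complex.Im (f (z + t%:C * v))) 0 1.

Definition pderiv v f z : R[i] :=
  derive1 (fun t : R => complex.Re (f (z + t%:C * v))) 0 +i*
  derive1 (fun t : R => complex.Im (f (z + t%:C * v))) 0.

Definition dz f z : R[i] := 2%:R^-1 * (pderiv 1 f z - 'i * pderiv 'i f z).
Definition dzbar f z : R[i] := 2%:R^-1 * (pderiv 1 f z + 'i * pderiv 'i f z).

Fixpoint Ck (k : nat) (V : set R[i]) f : Prop :=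
  (forall z, V z -> {for z, continuous (f : R[i]^o -> R[i]^o)}) /\
  if k is k'.+1 then
    (forall z, V z -> pderivable 1 f z /\ pderivable 'i f z) /\
    Ck k' V (pderiv 1 f) /\ Ck k' V (pderiv 'i f)
  else True.

Definition Cinfty (V : set R[i]) f : Prop := forall k, Ck k V f.

End PlaneCalculus.

(* [param i] is inverse to [chart i]; its values outside the image
   [chart i @` cdom i] are irrelevant.  Second countability is not required:
   by Rado's theorem it is automatic for connected surfaces. *)
Record riemann_surface (R : realType) := RiemannSurface {
  rs_space :> topologicalType;
  rs_hausdorff : hausdorff_space rs_space;
  rs_index : Type;
  cdom : rs_index -> set rs_space;
  chart : rs_index -> rs_space -> R[i];
  param : rs_index -> R[i] -> rs_space;
  cdom_open : forall i, open (cdom i);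
  cdom_cover : forall x, exists i, cdom i x;
  cimage_open : forall i, open (chart i @` cdom i : set R[i]^o);
  chartK : forall i x, cdom i x -> param i (chart i x) = x;
  chart_continuous : forall i x, cdom i x -> 
    {for x, continuous (chart i : rs_space -> R[i]^o)};
  param_continuous : forall i z, (chart i @` cdom i) z ->
    {for z, continuous (param i : R[i]^o -> rs_space)};
  chart_holomorphic : forall i j z, (chart i @` (cdom i `&` cdom j)) z ->
    derivable (chart j \o param i : R[i]^o -> R[i]^o) z 1
}.

Section Maps.
Variables (R : realType) (M : riemann_surface R).

Definition cimage (i : rs_index M) : set R[i] := chart i @` cdom i.

Definition smooth m n (f : M -> 'M[R[i]]_(m, n)) : Prop :=
  forall (i : rs_index M) a b, Cinfty (cimage i) (fun w => f (param i w) a b).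

(* The entrywise derivatives of f in the local coordinate [chart i]; they are
   meaningful at the points of [cdom i]. *)
Definition d_z m n (i : rs_index M) (f : M -> 'M[R[i]]_(m, n)) (x : M) :
    'M[R[i]]_(m, n) :=
  \matrix_(a, b) dz (fun w => f (param i w) a b) (chart i x).

Definition d_zbar m n (i : rs_index M) (f : M -> 'M[R[i]]_(m, n)) (x : M) :
    'M[R[i]]_(m, n) :=
  \matrix_(a, b) dzbar (fun w => f (param i w) a b) (chart i x).

(* A map f into a submanifold N of the Euclidean space of n x n matrices, with
   inner product Re tr (X Y^* ), is harmonic iff its tension field vanishes.
   The tension field is the tangential part of the Laplacian of f, that is, up
   to a positive factor, of d_z (d_zbar f).  [T p] is the tangent space of N at
   the point p. *)
Definition harmonic_into n (T : 'M[R[i]]_n -> set 'M[R[i]]_n)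
    (f : M -> 'M[R[i]]_n) : Prop :=
  forall (i : rs_index M) x, cdom i x -> forall X, T (f x) X ->
    complex.Re (\tr (d_z i (d_zbar i f) x *m X ^t*)) = 0.

End Maps.

Section PlaneRules.
Variable R : realType.
Implicit Types (f g : R[i] -> R[i]) (v z : R[i]).

Let has_pderiv v f z (d : R[i]) : Prop :=
  is_derive (0 : R) 1 (fun t : R => complex.Re (f (z + t%:C * v))) (complex.Re d) /\
  is_derive (0 : R) 1 (fun t : R => complex.Im (f (z + t%:C * v))) (complex.Im d).

Let pderivableP v f z : pderivable v f z -> has_pderiv v f z (pderiv v f z).
Proof.
case=> dr di; split; rewrite /= derive1E; exact: derivableP.
Qed.

Let has_pderivE v f z d : has_pderiv v f z d -> pderiv v f z = d.
Proof.
case=> dr di; rewrite /pderiv !derive1E !derive_val; by case: d {dr di}.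
Qed.

Let has_pderivM v f g z df dg : has_pderiv v f z df -> has_pderiv v g z dg ->
  has_pderiv v (fun w => f w * g w) z (df * g z + f z * dg).
Proof.
have z0 : z + (0 : R)%:C * v = z by rewrite mul0r addr0.
move=> [fr fi] [gr gi]; split.
- have -> : (fun t : R => complex.Re (f (z + t%:C * v) * g (z + t%:C * v))) =
    (fun t : R => complex.Re (f (z + t%:C * v))) *
      (fun t : R => complex.Re (g (z + t%:C * v))) -
    (fun t : R => complex.Im (f (z + t%:C * v))) *
      (fun t : R => complex.Im (g (z + t%:C * v))).
    apply/funext => t; rewrite !fctE.
    by case: (f _) => ? ?; case: (g _).
  apply: is_derive_eq; rewrite z0.
  case: (f z) => a b; case: (g z) => c d; case: df {fr fi} => a' b'.
  by case: dg {gr gi} => c' d' /=; rewrite /GRing.scale /=; ring.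
- have -> : (fun t : R => complex.Im (f (z + t%:C * v) * g (z + t%:C * v))) =
    (fun t : R => complex.Re (f (z + t%:C * v))) *
      (fun t : R => complex.Im (g (z + t%:C * v))) +
    (fun t : R => complex.Im (f (z + t%:C * v))) *
      (fun t : R => complex.Re (g (z + t%:C * v))).
    apply/funext => t; rewrite !fctE.
    by case: (f _) => ? ?; case: (g _).
  apply: is_derive_eq; rewrite z0.
  case: (f z) => a b; case: (g z) => c d; case: df {fr fi} => a' b'.
  by case: dg {gr gi} => c' d' /=; rewrite /GRing.scale /=; ring.
Qed.

Let has_pderiv_sum v m (F : 'I_m -> R[i] -> R[i]) z (d : 'I_m -> R[i]) :
  (forall j, has_pderiv v (F j) z (d j)) ->
  has_pderiv v (fun w => \sum_(j < m) F j w) z (\sum_(j < m) d j).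
Proof.
move=> Fd; split.
- have -> : (fun t : R => complex.Re (\sum_(j < m) F j (z + t%:C * v))) =
     \sum_(j < m) (fun t : R => complex.Re (F j (z + t%:C * v))).
    by apply/funext => t; rewrite raddf_sum fct_sumE.
  by rewrite raddf_sum; apply: is_derive_sum => j; case: (Fd j).
- have -> : (fun t : R => complex.Im (\sum_(j < m) F j (z + t%:C * v))) =
     \sum_(j < m) (fun t : R => complex.Im (F j (z + t%:C * v))).
    by apply/funext => t; rewrite raddf_sum fct_sumE.
  by rewrite raddf_sum; apply: is_derive_sum => j; case: (Fd j).
Qed.

Lemma pderiv_dot v m (F G : 'I_m -> R[i] -> R[i]) z :
  (forall j, pderivable v (F j) z) -> (forall j, pderivable v (G j) z) ->
  pderiv v (fun w => \sum_(j < m) F j w * G j w) z =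
  \sum_(j < m) (pderiv v (F j) z * G j z + F j z * pderiv v (G j) z).
Proof.
move=> Fd Gd; apply: has_pderivE; apply: has_pderiv_sum => j.
by apply: has_pderivM; apply: pderivableP.
Qed.

End PlaneRules.

Section Leibniz.
Variables (R : realType) (M : riemann_surface R).

Lemma d_zM m n p (i : rs_index M) (f : M -> 'M[R[i]]_(m, n))
    (g : M -> 'M[R[i]]_(n, p)) x :
  smooth f -> smooth g -> cdom i x ->
  d_z i (fun y => f y *m g y) x = d_z i f x *m g x + f x *m d_z i g x.
Proof.
move=> fs gs ix; apply/matrixP => a b; rewrite !mxE /dz.
have zi : cimage i (chart i x) by exists x.
have df c : pderivable 1 (fun w => f (param i w) a c) (chart i x) /\
    pderivable 'i (fun w => f (param i w) a c) (chart i x).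
  by have [_ [H _]] := fs i a c 1%N; apply: H.
have dg c : pderivable 1 (fun w => g (param i w) c b) (chart i x) /\
    pderivable 'i (fun w => g (param i w) c b) (chart i x).
  by have [_ [H _]] := gs i c b 1%N; apply: H.
have -> : (fun w => (f (param i w) *m g (param i w)) a b) =
   (fun w => \sum_(j < n) f (param i w) a j * g (param i w) j b).
  by apply/funext => w; rewrite mxE.
rewrite !pderiv_dot; try by move=> c; case: (df c); case: (dg c).
rewrite mulr_sumr -sumrB mulr_sumr -big_split /=.
by apply: eq_bigr => j _; rewrite !mxE /dz chartK //; ring.
Qed.

End Leibniz.

(* A subspace of C^n (column vectors) is represented by the orthogonal
   projection onto it, so that a map into the Grassmannian, or a subbundle psi
   of M x C^n, is the matrix-valued map x |-> pi_psi(x). *)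
Section Grassmannian.
Variables (R : realType) (n : nat).

Definition grassmannian (k : nat) : set 'M[R[i]]_n :=
  [set P | [/\ P *m P = P, P ^t* = P & \rank P = k]].

Definition tangent_grassmannian (P : 'M[R[i]]_n) : set 'M[R[i]]_n :=
  [set X | X ^t* = X /\ X *m P + P *m X = X].

Definition tangent_unitary (g : 'M[R[i]]_n) : set 'M[R[i]]_n :=
  [set X | (g ^t* *m X) ^t* = - (g ^t* *m X)].

Definition space (P : 'M[R[i]]_n) : set 'cV[R[i]]_n := [set v | P *m v = v].

End Grassmannian.

Section Bundles.
Variables (R : realType) (M : riemann_surface R) (n : nat).
Implicit Types (phi psi chi alpha : M -> 'M[R[i]]_n).

Definition subbundle psi : Prop :=
  smooth psi /\ exists k, forall x, grassmannian k (psi x).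

Definition compl psi : M -> 'M[R[i]]_n := fun x => 1%:M - psi x.

Definition orthogonal_bundles psi chi : Prop :=
  forall x, psi x *m chi x = 0.

(* A'_{psi,chi} maps v in psi_x to the projection onto chi_x of the derivative
   at x of any section of psi with value v at x, for instance of
   y |-> pi_psi(y) v; see [sff_section].  It is extended by 0 to psi_x^perp. *)
Definition sff (i : rs_index M) psi chi (x : M) : 'M[R[i]]_n :=
  chi x *m d_z i psi x *m psi x.

Definition sff_perp (i : rs_index M) psi : M -> 'M[R[i]]_n :=
  sff i psi (compl psi).

(* chi is the image of A'_psi with the zeros filled out: the two agree off a
   closed discrete set.  The image does not depend on the chart. *)
Definition fills_image psi chi : Prop :=
  subbundle chi /\
  forall (i : rs_index M) x, cdom i x ->
    \forall y \near x^', space (chi y) = mulmx (sff_perp i psi y) @` space (psi y).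

(* The default value 0 is never taken when psi is harmonic, as then the
   image of A'_psi always extends to a (unique) subbundle. *)
Definition gauss_transform psi : M -> 'M[R[i]]_n :=
  xget (fun=> 0) [set chi | fills_image psi chi].

Definition gauss (i : nat) phi : M -> 'M[R[i]]_n := iter i gauss_transform phi.

Definition isotropic phi (r : nat) : Prop :=
  forall i : nat, (1 <= i <= r)%N -> orthogonal_bundles phi (gauss i phi).

Definition finite_isotropy_order phi (r : nat) : Prop :=
  [/\ (1 <= r)%N, isotropic phi r & forall r', isotropic phi r' -> (r' <= r)%N].

(* The summands are mutually orthogonal when r is the isotropy order; see
   [remainder_space]. *)
Definition remainder phi (r : nat) : M -> 'M[R[i]]_n :=
  fun x => 1%:M - \sum_(0 <= i < r.+1) gauss i phi x.

Fixpoint sff_chain (i : rs_index M) phi (r : nat) (x : M) : 'M[R[i]]_n :=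
  if r is r'.+1 then sff_perp i (gauss r' phi) x *m sff_chain i phi r' x
  else phi x.

Definition first_return phi (r : nat) (i : rs_index M) (x : M) : 'M[R[i]]_n :=
  sff i (gauss r phi) phi x *m sff_chain i phi r x.

Definition second_return phi (r : nat) (i : rs_index M) (x : M) : 'M[R[i]]_n :=
  sff i (remainder phi r) phi x *m sff i (gauss r phi) (remainder phi r) x
    *m sff_chain i phi r x.

(* T is a bundle endomorphism of psi, given in each chart. *)
Definition power_zero_on psi (T : rs_index M -> M -> 'M[R[i]]_n) (p : nat) :
    Prop :=
  forall (i : rs_index M) x, cdom i x -> forall v, space (psi x) v ->
    T i x ^+ p *m v = 0.

Definition nilorder_on psi (T : rs_index M -> M -> 'M[R[i]]_n) (p : nat) :
    Prop :=
  power_zero_on psi T p /\ forall q, power_zero_on psi T q -> (p <= q)%N.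

Definition nilpotent_on psi (T : rs_index M -> M -> 'M[R[i]]_n) : Prop :=
  exists p, power_zero_on psi T p.

Definition return_D phi (r s : nat) (i : rs_index M) (x : M) : 'M[R[i]]_n :=
  first_return phi r i x *m second_return phi r i x ^+ s.

Definition harmonic_grassmannian (k : nat) phi : Prop :=
  [/\ smooth phi, forall x, grassmannian k (phi x) &
      harmonic_into (@tangent_grassmannian R n) phi].

Definition harmonic_unitary phi : Prop :=
  [/\ smooth phi, forall x, phi x \is unitarymx &
      harmonic_into (@tangent_unitary R n) phi].

Definition A_z phi (i : rs_index M) (x : M) : 'M[R[i]]_n :=
  2%:R^-1 *: (invmx (phi x) *m d_z i phi x).

Definition A_zbar phi (i : rs_index M) (x : M) : 'M[R[i]]_n :=
  2%:R^-1 *: (invmx (phi x) *m d_zbar i phi x).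

Definition uniton phi alpha : Prop :=
  [/\ harmonic_unitary phi, subbundle alpha &
    forall s : M -> 'cV[R[i]]_n, smooth s ->
      (forall x, space (alpha x) (s x)) ->
      forall (i : rs_index M) x, cdom i x ->
        space (alpha x) (d_zbar i s x + A_zbar phi i x *m s x) /\
        space (alpha x) (A_z phi i x *m s x)].

Fixpoint uniton_product (phi0 : 'M[R[i]]_n) (alpha : nat -> M -> 'M[R[i]]_n)
    (s : nat) (x : M) : 'M[R[i]]_n :=
  if s is s'.+1 then
    uniton_product phi0 alpha s' x *m (alpha s' x - compl (alpha s') x)
  else phi0.

Definition finite_uniton_number_unitary phi : Prop :=
  exists (s : nat) (phi0 : 'M[R[i]]_n) (alpha : nat -> M -> 'M[R[i]]_n),
    [/\ phi0 \is unitarymx,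
        forall j, (j < s)%N -> uniton (uniton_product phi0 alpha j) (alpha j) &
        forall x, phi x = uniton_product phi0 alpha s x].

Definition finite_uniton_number phi : Prop :=
  finite_uniton_number_unitary (fun x => phi x - compl phi x).

End Bundles.

Section BundleFacts.
Variables (R : realType) (M : riemann_surface R) (n : nat).

Lemma sff_section (i : rs_index M) (psi chi : M -> 'M[R[i]]_n)
    (s : M -> 'cV[R[i]]_n) x :
  subbundle psi -> subbundle chi -> orthogonal_bundles psi chi ->
  smooth s -> (forall y, space (psi y) (s y)) -> cdom i x ->
  sff i psi chi x *m s x = chi x *m d_z i s x.
Proof.
move=> [ps [k pk]] [_ [l cl]] pc ss sp ix.
have cp : chi x *m psi x = 0.
  case: (pk x) => _ ph _; case: (cl x) => _ ch _.
  have := congr1 (fun A => A ^t*) (pc x).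
  by rewrite /= trmx_mul map_mxM ph ch trmx0 map_mx0.
have {2}-> : s = fun y => psi y *m s y by apply/funext => y; rewrite sp.
rewrite d_zM // mulmxDr [chi x *m (psi x *m _)]mulmxA cp mul0mx addr0.
by rewrite /sff -!mulmxA sp.
Qed.

Lemma remainder_space (phi : M -> 'M[R[i]]_n) (r : nat) x :
  (forall j, gauss j phi x *m gauss j phi x = gauss j phi x) ->
  (forall j l, (j <= r)%N -> (l <= r)%N -> j != l ->
     gauss j phi x *m gauss l phi x = 0) ->
  space (remainder phi r x) =
  [set v | forall j, (j <= r)%N -> gauss j phi x *m v = 0].
Proof.
move=> idem orth; apply/seteqP; split => v; rewrite /space /remainder /=.
  rewrite mulmxBl mul1mx => Sv j jr.
  have S0 : (\sum_(0 <= l < r.+1) gauss l phi x) *m v = 0.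
    by rewrite -[LHS](subKr v) Sv subrr.
  have := congr1 (mulmx (gauss j phi x)) S0.
  rewrite mulmx0 mulmxA mulmx_sumr big_mkord.
  rewrite (bigD1 (Ordinal (jr : (j < r.+1)%N))) //= idem big1 ?addr0 // => l lj.
  by apply: orth => //; [rewrite -ltnS | apply: contraNneq lj => jl; apply/eqP/val_inj].
move=> v0; rewrite mulmxBl mul1mx mulmx_suml big_mkord big1 ?subr0 // => j _.
by apply: v0; rewrite -ltnS.
Qed.

End BundleFacts.

(* Main.v *)
From HB Require Import structures.
Require Import Defs.
From mathcomp Require Import ring lra zify.

Set Implicit Arguments.
Unset Strict Implicit.
Unset Printing Implicit Defensive.

(**
A finite uniton number provides a gauge transformation [Phi], polynomial in [t = lambda^-1] with a
polynomial inverse up to a power of [t], that conjugates [d/dz] to [d/dz + (1 - t) A_z].  Hence the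
powers of this operator, all of them, have bounded degree in [t].  Split [C^n] as
[G^(0) + ... + G^(r) + R] and spread the powers of [t] evenly over this cycle by a further diagonal
gauge transformation: the operator becomes [nabla + k C + k^2 a], where [nabla] is block diagonal,
[C] moves one step along the cycle [G^(0) -> ... -> G^(r) -> R -> G^(0)] and [a : G^(r) -> G^(0)] is
the short cut, so that [c] is [a C^r] and [e] is [C^(r+2)] on [phi].  With [n = s (r+2) + r], the
hypotheses say that [a C^j a = 0] for [j < n].  Give the letters [nabla], [C], [a] the weights
[n+2], [1], [-n]: the only words of lowest weight which survive are the [(a C^n)^p a], so these are
coefficients of high degree in [k], and vanish for large [p].  As [a C^n] is [c e^s] on [phi], the
map [c e^s] is nilpotent.

All this takes place in the ring of smooth functions on the image of a chart, a commutative ring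
with two commuting derivations exchanged by conjugation.  There, the fact that [G^(i+1)] fills out
the image of [A'_{G^(i)}] becomes the possibility of cancelling [A'_{G^(i)}] on the right.
*)

(** The minimal polynomial divides a power of [X], so it is itself a power of [X], of degree at most
    [n] since it divides the characteristic polynomial. This makes the exponent independent of the
    point and of the chart. *)
Lemma nilpotent_mx_dim (F : fieldType) (n p : nat) (A : 'M[F]_n) :
  A ^+ p = 0 -> A ^+ n = 0.
Proof.
case: n A => [|n] A Ap; first by apply/matrixP => -[].
have hX q : horner_mx A ('X ^+ q) = A ^+ q by rewrite rmorphXn /= horner_mx_X.
have : mxminpoly A %| ('X - 0%:P) ^+ p by apply: mxminpoly_min; rewrite subr0 hX.
case/dvdp_exp_XsubCP => k _ Ak.
have kn : (k <= n.+1)%N.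
  rewrite -ltnS -(size_exp_XsubC k (0 : F)) -(eqp_size Ak) -(size_char_poly A).
  by apply: dvdp_leq; [rewrite -size_poly_eq0 size_char_poly | exact: mxminpoly_dvd_char].
rewrite -hX (_ : 'X^(n.+1) = 'X^(n.+1 - k) * 'X^k); last by rewrite -exprD subnK.
rewrite rmorphM /=.
have : mxminpoly A %| 'X^k by rewrite (eqp_dvdl _ Ak) subr0.
by case/dvdpP => q ->; rewrite rmorphM /= mx_root_minpoly !mulr0.
Qed.

(** * Words in three operators *)

Section ReturnNilpotent.
Variables (V : zmodType) (nabla : V -> V) (C a : {additive V -> V}) (n : nat).
Variables (u : nat -> nat -> V).
Hypothesis nabla0 : nabla 0 = 0.
Hypothesis u0 : forall d, (0 < d)%N -> u 0 d = 0.
Hypothesis uS : forall m d, u m.+1 d = nabla (u m d) +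
  (if d is d'.+1 then C (u m d') else 0) +
  (if d is d'.+2 then a (u m d') else 0).
Hypothesis aCa : forall j x, (j < n)%N -> a (iter j C (a x)) = 0.

Let iterCD j x y : iter j C (x + y) = iter j C x + iter j C y.
Proof. by elim: j => //= j ->; rewrite raddfD. Qed.

Let iterC0 j : iter j C 0 = 0.
Proof. by elim: j => //= j ->; rewrite raddf0. Qed.

(* [u m d] is the sum of the words of [m] letters and total degree [d], where [nabla], [C], [a] have
   degrees 0, 1, 2; its weight is [(n+2) m - (n+1) d], so that the letters weigh [n+2], [1], [-n]. *)
Lemma path_vanish m d :
  ((n.+2 * m + n < n.+1 * d)%N -> u m d = 0) /\
  (forall j, (n.+2 * m + j < n.+1 * d)%N -> a (iter j C (u m d)) = 0).
Proof.
elim: m d => [|m IH] d.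
  case: d => [|d]; first by split => [|j]; rewrite !muln0.
  by rewrite u0 //; split => // j _; rewrite iterC0 raddf0.
split=> [lt|j lt].
  rewrite uS (IH d).1 ?nabla0 ?raddf0 ?add0r; last by lia.
  case: d lt => [|d] lt; first by rewrite addr0.
  rewrite (IH d).1 ?nabla0 ?raddf0 ?add0r; last by lia.
  case: d lt => [//|d] lt.
  by apply: ((IH d).2 0); lia.
rewrite uS (IH d).1 ?nabla0 ?raddf0 ?add0r; last by lia.
case: d lt => [|d] lt; first by rewrite addr0 iterC0 raddf0.
rewrite iterCD raddfD /= -iterSr (IH d).2 ?add0r; last by lia.
case: d lt => [|d] lt; first by rewrite iterC0 raddf0.
(* For [n <= j] the weight is so negative that [a (u m d)] vanishes already, by the case [j = 0] of
   the second induction hypothesis. *)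
case: (ltnP j n) => jn; first exact: aCa.
have -> : a (u m d) = 0 by apply: ((IH d).2 0); lia.
by rewrite iterC0 raddf0.
Qed.

(** The pair [(m, d)] has weight [-n], and [(m + t, d + t)] has weight [t - n]. A last letter
    [nabla] would leave a word of weight below [-n], which vanishes by [path_vanish]; a last letter
    [a] is killed by [a C^j a = 0]. Only [C] is left. *)
Lemma path_follow m d t j : (n.+2 * m + n = n.+1 * d)%N -> (t <= n)%N ->
  (j <= n - t)%N ->
  a (iter j C (u (m + t) (d + t) - iter t C (u m d))) = 0.
Proof.
move=> md; elim: t j => [|t IH] j tn jt.
  by rewrite !addn0 subrr iterC0 raddf0.
rewrite !addnS uS (path_vanish _ _).1 ?nabla0 ?raddf0 ?add0r; last by lia.
rewrite addrAC iterCD raddfD /= -raddfB -iterSr IH ?add0r; [|lia|lia].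
case E : (d + t)%N => [|x]; first by rewrite iterC0 raddf0.
by apply: aCa; lia.
Qed.

(** A round has [n] letters [C] and one letter [a], hence length [n + 1], degree [n + 2] and total
    weight 0: the weight [-n] is reproduced. *)
Lemma path_round m d : (n.+2 * m + n = n.+1 * d)%N ->
  u (m + n.+1) (d + n.+2) = a (iter n C (u m d)).
Proof.
move=> md; rewrite !addnS uS (path_vanish _ _).1 ?nabla0 ?raddf0 ?add0r; last by lia.
rewrite (path_vanish _ _).1 ?nabla0 ?raddf0 ?add0r; last by lia.
apply/eqP; rewrite -subr_eq0 -raddfB; apply/eqP.
by apply: (path_follow (j := 0) md).
Qed.

Lemma path_rounds p : u (1 + p * n.+1) (2 + p * n.+2) =
  iter p (fun x => a (iter n C x)) (a (u 0 0)).
Proof.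
elim: p => [|p IH].
  (* The starting word [a] has length 1 and degree 2, hence weight [-n]; the other two letters
     contribute nothing because [u 0 2 = u 0 1 = 0]. *)
  by rewrite !mul0n !addn0 uS (u0 (d := 2)) // (u0 (d := 1)) // nabla0 !raddf0 !add0r.
by rewrite 2!mulSnr 2!addnA path_round; [rewrite IH | lia].
Qed.
End ReturnNilpotent.

(** * Derivations on matrices and polynomials, and the extended solution *)

Section MatrixDerivation.
Variables (K : comNzRingType) (d : {additive K -> K}).
Hypothesis dM : forall x y, d (x * y) = d x * y + x * d y.

Lemma map_mx_derivM m n p (A : 'M[K]_(m, n)) (B : 'M[K]_(n, p)) :
  map_mx d (A *m B) = map_mx d A *m B + A *m map_mx d B.
Proof.
apply/matrixP => i j; rewrite !mxE raddf_sum -big_split /=.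
by apply: eq_bigr => k _; rewrite !mxE dM.
Qed.

Lemma deriv1 : d 1 = 0.
Proof.
have := dM 1 1; rewrite !mulr1 mul1r => /eqP.
by rewrite -subr_eq subrr eq_sym => /eqP.
Qed.

Lemma map_mx_deriv_scalar m c : d c = 0 -> map_mx d (c%:M : 'M[K]_m) = 0.
Proof.
by move=> c0; apply/matrixP => i j; rewrite !mxE; case: eqP => _; rewrite ?c0 ?raddf0.
Qed.

Lemma map_mx_derivZ m n c (A : 'M[K]_(m, n)) : d c = 0 ->
  map_mx d (c *: A) = c *: map_mx d A.
Proof.
by move=> c0; apply/matrixP => i j; rewrite !mxE dM c0 mul0r add0r.
Qed.

Lemma map_poly_derivM (p q : {poly K}) :
  map_poly d (p * q) = map_poly d p * q + p * map_poly d q.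
Proof.
apply/polyP => k; rewrite coef_map coefD !coefM raddf_sum -big_split /=.
by apply: eq_bigr => i _; rewrite !coef_map dM.
Qed.

Lemma map_poly_derivXn k : map_poly d ('X^k) = 0.
Proof.
apply/polyP => i; rewrite coef_map coef0 coefXn.
by case: eqP => _ /=; rewrite ?deriv1 ?raddf0.
Qed.

Section Bounded.
Variables (m : nat) (B B' : 'M[{poly K}]_m) (q : nat) (T : 'M[{poly K}]_m -> 'M[{poly K}]_m).
Hypothesis BB : B' *m B = 'X^q%:M.
Hypothesis BT : forall v, B *m T v = map_mx (map_poly d) (B *m v).

(* [B] conjugates [T] to the derivation, which does not raise degrees. *)
Lemma iter_gauge_bounded : exists b, forall k i j e, (b <= e)%N ->
  (iter k T 1%:M i j)`_e = 0.
Proof.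
have Bk k : B *m iter k T 1%:M = iter k (map_mx (map_poly d)) B.
  by elim: k => [|k IH]; rewrite ?mulmx1 //= BT IH.
pose b0 (M : 'M[{poly K}]_m) := \max_i \max_j size (M i j).
have b0P (M : 'M[{poly K}]_m) i j : (size (M i j) <= b0 M)%N.
  apply: leq_trans (leq_bigmax (F := fun l => \max_l' size (M l l')) i).
  exact: (leq_bigmax (F := fun l => size (M i l))).
have sk k i j : (size (iter k (map_mx (map_poly d)) B i j) <= b0 B)%N.
  elim: k i j => [|k IH] i j //=.
  by rewrite mxE; apply: leq_trans (size_poly _ _) (IH i j).
(* The coefficient of index [e] of [T^k 1] is the coefficient of index [q + e] of [B'] times the
   [k]-th derivative of [B], whose degree is bounded independently of [k]. *)
exists (b0 B' + b0 B)%N => k i j e be.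
have : ('X^q *: iter k T 1%:M) i j =  (B' *m (B *m iter k T 1%:M)) i j.
  by rewrite mulmxA BB mul_scalar_mx.
rewrite Bk !mxE => /(congr1 (fun p : {poly K} => p`_(q + e))).
rewrite coefXnM ltnNge leq_addr /= addnC addnK => ->.
rewrite coef_sum big1 // => l _; apply: nth_default.
apply: leq_trans (size_polyMleq _ _) _.
have := b0P B' i l; have := sk k l j; move: be; lia.
Qed.
End Bounded.

(* [Phi] is the extended solution of the unitons [alpha], rescaled so that it is polynomial in
   [t = lambda^-1]. *)
Lemma uniton_extended_solution m N (alpha A : nat -> 'M[K]_m) (t : K) :
  d t = 0 -> A 0%N = 0 -> (forall j, A j.+1 = A j - map_mx d (alpha j)) ->
  (forall j, (j < N)%N -> [/\ alpha j *m alpha j = alpha j,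
      (1%:M - alpha j) *m A j *m alpha j = 0 &
      alpha j *m A j *m (1%:M - alpha j) = alpha j *m map_mx d (alpha j)]) ->
  exists Phi Psi : 'M[K]_m,
    Psi *m Phi = (t ^+ N)%:M /\ map_mx d Phi = (1 - t) *: (Phi *m A N).
Proof.
move=> dt A0 AS; elim: N => [|N IH] H.
  exists 1%:M, 1%:M; rewrite mulmx1 expr0; split=> //.
  by rewrite A0 mulmx0 scaler0 map_mx_deriv_scalar // deriv1.
have [|Phi [Psi [PP dP]]] := IH; first by move=> j jN; apply: H; apply: ltnW.
have [aa h1 h2] := H N (leqnn _).
set al := alpha N in aa h1 h2; set AN := A N in h1 h2 dP.
have dbe : map_mx d (1%:M - al) = - map_mx d al.
  by rewrite raddfB /= map_mx_deriv_scalar ?deriv1 // sub0r.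
(* By [e1] and [e2] the uniton conditions intertwine [AN] with [AN - d al], the next [A]: directly
   on [al], and with a derivative as correction on its complement. *)
have e1 : AN *m al = al *m (AN - map_mx d al).
  rewrite mulmxBr -h2 mulmxBr mulmx1 opprB addrCA subrr addr0.
  by apply/eqP; rewrite -subr_eq0 -{1}[AN]mul1mx -!mulmxBl h1.
have e2 : AN *m (1%:M - al) - map_mx d al = (1%:M - al) *m (AN - map_mx d al).
  by rewrite mulmxBr mulmx1 mulmxBl mul1mx -e1 addrAC.
have ab : al *m (1%:M - al) = 0 by rewrite mulmxBr mulmx1 aa subrr.
have ba : (1%:M - al) *m al = 0 by rewrite mulmxBl mul1mx aa subrr.
have bb : (1%:M - al) *m (1%:M - al) = 1%:M - al.
  by rewrite mulmxBr mulmx1 ba subr0.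
have ab1 : al + (1%:M - al) = 1%:M by rewrite addrC subrK.
move: (1%:M - al) dbe e2 ab ba bb ab1 {h1 h2} => be dbe e2 ab ba bb ab1.
(* The product of [al + t be] and [t al + be] is [t], which supplies the additional power of [t]. *)
exists (Phi *m (t *: al + be)), ((al + t *: be) *m Psi); split.
  rewrite -mulmxA (mulmxA Psi) PP mul_scalar_mx -scalemxAr.
  rewrite mulmxDl !mulmxDr -!scalemxAl -!scalemxAr aa ab ba bb !scaler0.
  by rewrite addr0 add0r -scalerDr ab1 scalerA -exprSr scalemx1.
rewrite map_mx_derivM dP map_mxD map_mx_derivZ // dbe AS -/al -/AN.
rewrite -scalemxAl -!mulmxA.
have -> : t *: map_mx d al - map_mx d al = (1 - t) *: - map_mx d al.
  by rewrite scalerN scalerBl scale1r opprB.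
rewrite -scalemxAr -scalerDr -mulmxDr; congr (_ *: (_ *m _)).
by rewrite mulmxDr mulmxDl -scalemxAr -scalemxAl e1 -addrA e2.
Qed.

End MatrixDerivation.

(** * Cyclic frames of idempotents and their gauge transformations *)

Section Frame.
Variables (K : comNzRingType) (d : {additive K -> K}).
Hypothesis dM : forall x y, d (x * y) = d x * y + x * d y.
Variables (m r : nat) (pi : nat -> 'M[K]_m).
Local Notation D := (map_mx d).

(** For [j != i] this is the second fundamental form from [pi i] to [pi j], extended by zero. *)
Definition block (j i : nat) : 'M[K]_m := pi j *m D (pi i) *m pi i.

Definition is_frame : Prop :=
  (forall i j, (i < r.+2)%N -> (j < r.+2)%N ->
     pi i *m pi j = if i == j then pi i else 0) /\
  \sum_(i < r.+2) pi i = 1%:M.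

(* Index [r+1] stands for [R]; the allowed transitions are [i -> i+1] modulo [r+2], and [r -> 0]. *)
Definition cyclic_frame : Prop :=
  forall i j, (i < r.+2)%N -> (j < r.+2)%N -> i != j -> j != i.+1 ->
    ~~ ((j == 0%N) && (r <= i)%N) -> block j i = 0.

(** [short_step], [cycle_step] and [diag_deriv] are the letters [a], [C] and [nabla]. *)
Definition short_step : 'M[K]_m := block 0 r.

Definition cycle_step : 'M[K]_m :=
  \sum_(i < r.+1) block i.+1 i + block 0 r.+1.

Definition diag_deriv (v : 'M[K]_m) : 'M[K]_m :=
  \sum_(i < r.+2) pi i *m D (pi i *m v).

(** The steps from [pi 0] to [pi 1] and from [R] to [pi 0] each carry a factor [t], so the cycle of
    [r + 2] steps carries [t^2]. With [t = th^(r+2)] every step gets [th^2], and the short cut,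
    which replaces two steps, gets [th^4]. Using [th] instead of [th^2] keeps the weights integral
    when [r] is odd. *)
Definition frame_weight (i : nat) : nat :=
  if i == 0%N then r else ((r.+1 - i) * 2)%N.

Hypothesis fr : is_frame.
Hypothesis cyc : cyclic_frame.
Hypothesis r_gt0 : (0 < r)%N.

Let pp i : (i < r.+2)%N -> pi i *m pi i = pi i.
Proof. by move=> ir; rewrite fr.1 // eqxx. Qed.
Let pp0 i j : (i < r.+2)%N -> (j < r.+2)%N -> i != j -> pi i *m pi j = 0.
Proof. by move=> ir jr ij; rewrite fr.1 // (negbTE ij). Qed.

Lemma frame_eq p (A B : 'M[K]_(m, p)) :
  (forall j, (j < r.+2)%N -> pi j *m A = pi j *m B) -> A = B.
Proof.
move=> AB; rewrite -[A]mul1mx -[B]mul1mx -fr.2 !mulmx_suml.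
by apply: eq_bigr => j _; apply: AB.
Qed.

Lemma mul_pi_block i j k : (j < r.+2)%N -> (k < r.+2)%N ->
  pi k *m block j i = if k == j then block j i else 0.
Proof.
move=> jr kr; rewrite /block !mulmxA fr.1 //.
by case: eqP => [->//|_]; rewrite !mul0mx.
Qed.

Lemma mul_block_pi i j k : (i < r.+2)%N -> (k < r.+2)%N ->
  block j i *m pi k = if i == k then block j i else 0.
Proof.
move=> ir kr; rewrite /block -!mulmxA fr.1 //.
by case: eqP => _ //; rewrite !mulmx0.
Qed.

(** Off the diagonal the derivative is tensorial: the Leibniz term containing [D v] is killed by
    [pi j pi i = 0]. *)
Lemma pi_deriv_off i j p (v : 'M[K]_(m, p)) : (i < r.+2)%N -> (j < r.+2)%N -> i != j ->
  pi j *m D (pi i *m v) = block j i *m v.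
Proof.
move=> ir jr ij; rewrite -{1}(pp ir) -mulmxA (map_mx_derivM dM) mulmxDr !mulmxA.
by rewrite pp0 ?(eq_sym j) // mul0mx addr0.
Qed.

Lemma deriv_pi_off i j : (i < r.+2)%N -> (j < r.+2)%N -> i != j ->
  D (pi j) *m pi i = - block j i.
Proof.
move=> ir jr ij; have ji : j != i by rewrite eq_sym.
apply/eqP; rewrite -addr_eq0 /block -{1}(pp ir) mulmxA -mulmxDl.
by rewrite -(map_mx_derivM dM) pp0 // map_mx0 mul0mx.
Qed.

Lemma block_diag i : (i < r.+2)%N -> block i i = 0.
Proof.
move=> ir; have := congr1 (fun X => pi i *m X *m pi i) (congr1 D (pp ir)).
rewrite (map_mx_derivM dM) mulmxDr mulmxDl !mulmxA (pp ir) -[_ *m pi i *m pi i]mulmxA (pp ir).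
by rewrite -[RHS]addr0 => /addrI.
Qed.

(** Compare components: besides the diagonal one, [cyclic_frame] allows only those in [i + 1] and,
    from index [r] on, in [0]. *)
Lemma deriv_pi i p (v : 'M[K]_(m, p)) : (i < r.+2)%N ->
  D (pi i *m v) = pi i *m D (pi i *m v) +
    ((if (i <= r)%N then block i.+1 i *m v else 0) +
     (if (r <= i)%N then block 0 i *m v else 0)).
Proof.
move=> ir; apply: frame_eq => j jr; rewrite !mulmxDr mulmxA.
have [->|ij] := eqVneq i j.
  rewrite pp // -[LHS]addr0; congr (_ + _).
  case: ifP => h; rewrite ?mulmx0 ?add0r.
    rewrite mulmxA mul_pi_block // ltn_eqF // mul0mx add0r.
    case: ifP => h'; rewrite ?mulmx0 // mulmxA mul_pi_block //.
    by rewrite (gtn_eqF (leq_trans r_gt0 h')) mul0mx.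
  case: ifP => h'; rewrite ?mulmx0 // mulmxA mul_pi_block //.
  by rewrite (gtn_eqF (leq_trans r_gt0 h')) mul0mx.
rewrite pi_deriv_off // fr.1 // eq_sym (negbTE ij) mul0mx add0r.
have m0 : block j i = (if (i <= r)%N && (j == i.+1) then block i.+1 i else 0) +
                      (if (r <= i)%N && (j == 0%N) then block 0 i else 0).
  have [ji|ji] := eqVneq j i.+1.
    by move: jr; rewrite ji => /= ir'; rewrite andbF addr0 andbT [(i <= r)%N]ir'.
  rewrite andbF add0r.
  case: (boolP ((r <= i)%N && (j == 0%N))) => [/andP[_ /eqP ->]//|h].
  by rewrite cyc // andbC.
rewrite m0 mulmxDl; congr (_ + _).
  case: ifP => [/andP[-> /eqP ji]|].
    by rewrite mulmxA mul_pi_block -?ji // eqxx.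
  case: ifP => /= h h2; rewrite ?mulmx0 ?mul0mx // mulmxA mul_pi_block //.
  by rewrite h2 mul0mx.
case: ifP => [/andP[-> /eqP ->]|].
  by rewrite mulmxA mul_pi_block // eqxx.
case: ifP => /= h h2; rewrite ?mulmx0 ?mul0mx // mulmxA mul_pi_block //.
by rewrite h2 mul0mx.
Qed.

Let A := pi 0%N *m D (pi 0%N) - (1%:M - pi 0%N) *m D (pi 0%N).

(** [A] is [A_z] of the reflection in [pi 0]. It collects, with reversed sign, exactly the steps
    that enter or leave [pi 0]; hence [D + (1 - t) A] multiplies these steps by [t] and leaves the
    others unchanged. *)
Lemma grassmannian_A_pi i : (i < r.+2)%N -> A *m pi i =
  - ((if i == 0%N then block 1 0 else 0) + (if (r <= i)%N then block 0 i else 0)).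
Proof.
move=> ir; rewrite /A mulmxBl -!mulmxA; have [i0|i0] := eqVneq i 0%N.
  have bd : pi 0%N *m (D (pi 0%N) *m pi 0%N) = 0 by rewrite mulmxA; exact: (@block_diag 0).
  rewrite i0 leqNgt r_gt0 addr0 mulmxBl mul1mx bd subr0 sub0r; congr (- _).
  have := deriv_pi (pi 0%N) (ltn0Sn r.+1).
  rewrite pp //= [(r <= 0)%N]leqNgt r_gt0 addr0 mul_block_pi // eqxx => /(congr1 (mulmx^~ (pi 0%N))).
  by rewrite mulmxDl mul_block_pi // eqxx -[X in _ = X + _]/(block 0 0) block_diag // add0r.
rewrite (@deriv_pi_off i 0) // !mulmxN mulmxBl mul1mx.
rewrite !mul_pi_block // eqxx subrr oppr0 subr0 add0r; congr (- _).
by case: ifP => // /negbT ri; rewrite cyc.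
Qed.

Lemma mul_cycle_step i : (i < r.+2)%N ->
  cycle_step *m pi i = if (i <= r)%N then block i.+1 i else block 0 i.
Proof.
move=> ir; rewrite mulmxDl mulmx_suml mul_block_pi //.
under eq_bigr => j _ do rewrite mul_block_pi ?(ltn_trans (ltn_ord j)) //.
case: (leqP i r) => ri.
  rewrite gtn_eqF ?ltnS // addr0 (bigD1 (Ordinal (ri : (i < r.+1)%N))) //= eqxx.
  rewrite big1 ?addr0 // => j ji; case: eqP => // ji'; case/eqP: ji.
  exact: val_inj.
have -> : i = r.+1 by apply/eqP; rewrite eqn_leq ri -ltnS ir.
by rewrite eqxx big1 ?add0r // => j _; rewrite ltn_eqF.
Qed.

Lemma mul_short_step i : (i < r.+2)%N ->
  short_step *m pi i = if i == r then short_step else 0.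
Proof. by move=> ir; rewrite /short_step mul_block_pi // eq_sym. Qed.

(* Here [th] plays the role of a power of [lambda^-1]: the gauge transformation by the powers
   [frame_weight] spreads the spectral parameter evenly over the steps of the cycle. *)
Lemma frame_gauge (th : K) (v : 'M[K]_m) : (forall k, d (th ^+ k) = 0) ->
  let g := \sum_(i < r.+2) th ^+ frame_weight i *: pi i in
  D (g *m v) + (1 - th ^+ r.+2) *: (A *m (g *m v)) =
  g *m (diag_deriv v + th ^+ 2 *: (cycle_step *m v) + th ^+ 4 *: (short_step *m v)).
Proof.
move=> dth g.
have gpi i : (i < r.+2)%N -> g *m pi i = th ^+ frame_weight i *: pi i.
  move=> ir; rewrite /g mulmx_suml (bigD1 (Ordinal ir)) //= -scalemxAl pp //.
  rewrite big1 ?addr0 // => j ji; rewrite -scalemxAl pp0 ?scaler0 //.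
have gblock j i : (j < r.+2)%N -> g *m (block j i *m v) = th ^+ frame_weight j *: (block j i *m v).
  by move=> jr; rewrite /block !mulmxA gpi // -!scalemxAl.
(* The two sides are compared on one idempotent at a time. The exponents 2 and 4 are the difference
   of [frame_weight] between source and target, increased by [r + 2] for the steps that carry
   [th^(r+2)]. *)
have term i : (i < r.+2)%N ->
    D (th ^+ frame_weight i *: (pi i *m v)) +
      (1 - th ^+ r.+2) *: (A *m (th ^+ frame_weight i *: (pi i *m v))) =
    g *m (pi i *m D (pi i *m v)) +
    ((if (i <= r)%N then th ^+ 2 *: (g *m (block i.+1 i *m v)) else 0) +
     (if (r <= i)%N then th ^+ (if i == r then 4 else 2) *: (g *m (block 0 i *m v)) else 0)).
  move=> ir; rewrite (map_mx_derivZ dM) // -scalemxAr scalerA mulrC -scalerA -scalerDr.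
  rewrite [in LHS]deriv_pi // [A *m _]mulmxA grassmannian_A_pi // [g *m (pi i *m _)]mulmxA gpi //.
  rewrite -scalemxAl -addrA scalerDr; congr (_ + _).
  have [i0|i0] := eqVneq i 0%N.
    rewrite i0 leq0n [(r <= 0)%N]leqNgt r_gt0 /= !addr0 gblock // !scalerA.
    rewrite mulNmx scalerN scalerBl scale1r opprB addrC subrK scalerA -!exprD.
    by congr (th ^+ _ *: _); rewrite /frame_weight /=; case: r r_gt0 => // r' _; lia.
  rewrite add0r.
  have -> : (if (r <= i)%N then block 0 i *m v else 0) =
     (if (r <= i)%N then block 0 i else 0) *m v by case: ifP => //; rewrite mul0mx.
  rewrite -addrA mulNmx scalerN scalerBl scale1r opprB [_ *m v + _]addrC subrK scalerDr.
  congr (_ + _).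
    case: ifP => ri; rewrite ?scaler0 // gblock // scalerA -exprD.
    congr (th ^+ _ *: _); rewrite /frame_weight (negbTE i0) /=; lia.
  case: ifP => ri; rewrite ?mul0mx ?scaler0 // gblock // !scalerA -!exprD.
  by congr (th ^+ _ *: _); rewrite /frame_weight (negbTE i0) /=; case: eqP; lia.
rewrite {1 2}/g mulmx_suml raddf_sum mulmx_sumr scaler_sumr -big_split /=.
under eq_bigr => i _ do rewrite -scalemxAl term ?ltn_ord //.
rewrite !big_split /= -mulmx_sumr -!addrA !mulmxDr; congr (_ + _).
have -> : cycle_step *m v = \sum_(i < r.+1) block i.+1 i *m v + block 0 r.+1 *m v.
  by rewrite mulmxDl mulmx_suml.
rewrite -!scalemxAr mulmxDr mulmx_sumr scalerDr scaler_sumr -addrA.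
congr (_ + _).
  rewrite big_ord_recr /= ltnn addr0; apply: eq_bigr => i _.
  by rewrite -ltnS ltn_ord.
rewrite big_ord_recr /= leqnSn gtn_eqF // addrC; congr (_ + _).
rewrite big_ord_recr /= leqnn eqxx big1 ?add0r // => i _.
by rewrite leqNgt ltn_ord.
Qed.

End Frame.

(** * Nilpotency of the return operator of a cyclic frame *)

Section FrameNilpotent.
Variables (K : comNzRingType) (d : {additive K -> K}).
Hypothesis dM : forall x y, d (x * y) = d x * y + x * d y.
Variables (m r : nat) (pi : nat -> 'M[K]_m).
Local Notation D := (map_mx d).
Hypothesis fr : is_frame r pi.
Hypothesis cyc : cyclic_frame d r pi.
Hypothesis r_gt0 : (0 < r)%N.

Local Notation polyCmx := (map_mx (@polyC K)).
Let pd : {additive {poly K} -> {poly K}} := map_poly d.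

Let pd_polyCmx p q (M : 'M[K]_(p, q)) : map_mx pd (polyCmx M) = polyCmx (D M).
Proof. by apply/matrixP => i j; rewrite !mxE /pd /= map_polyC. Qed.

Let polyCmx_block i j : block pd (fun k => polyCmx (pi k)) j i = polyCmx (block d pi j i).
Proof. by rewrite /block pd_polyCmx !map_mxM. Qed.

Let polyCmx_frame : is_frame r (fun k => polyCmx (pi k)).
Proof.
split=> [i j ir jr|].
  by rewrite -map_mxM fr.1 //; case: ifP => // _; rewrite map_mx0.
rewrite -(map_mx1 (@polyC K)) -fr.2.
by rewrite (raddf_sum (map_mx (@polyC K))).
Qed.

Let polyCmx_cyclic : cyclic_frame pd r (fun k => polyCmx (pi k)).
Proof. by move=> i j ir jr ij h1 h2; rewrite polyCmx_block cyc // map_mx0. Qed.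

Let cf e p q (M : 'M[{poly K}]_(p, q)) : 'M[K]_(p, q) := map_mx (coefp e) M.

Let cf_mul e p q s (M : 'M[K]_(p, q)) (N : 'M[{poly K}]_(q, s)) :
  cf e (polyCmx M *m N) = M *m cf e N.
Proof.
apply/matrixP => i j; rewrite !mxE /= coef_sum; apply: eq_bigr => k _.
by rewrite !mxE coefCM.
Qed.

Let cfD e p q (M N : 'M[{poly K}]_(p, q)) : cf e (M + N) = cf e M + cf e N.
Proof. exact: map_mxD. Qed.

Let cf_deriv e p q (M : 'M[{poly K}]_(p, q)) : cf e (map_mx pd M) = D (cf e M).
Proof. by apply/matrixP => i j; rewrite !mxE /= coef_map. Qed.

Let cf_shift e k p q (M : 'M[{poly K}]_(p, q)) :
  cf e ('X^k *: M) = if (e < k)%N then 0 else cf (e - k) M.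
Proof.
apply/matrixP => i j; rewrite !mxE /= coefXnM.
by case: ifP => _; rewrite !mxE.
Qed.

Section Unitons.
Variables (N : nat) (alpha A : nat -> 'M[K]_m).
Hypothesis A0 : A 0%N = 0.
Hypothesis AS : forall j, A j.+1 = A j - D (alpha j).
Hypothesis alphaP : forall j, (j < N)%N -> [/\ alpha j *m alpha j = alpha j,
      (1%:M - alpha j) *m A j *m alpha j = 0 &
      alpha j *m A j *m (1%:M - alpha j) = alpha j *m D (alpha j)].
Hypothesis AN : A N = pi 0%N *m D (pi 0%N) - (1%:M - pi 0%N) *m D (pi 0%N).

(** The operator [nabla + k C + k^2 a] with [k = X^2]; the polynomial variable [X] stands for
    [th]. *)
Let T (v : 'M[{poly K}]_m) : 'M[{poly K}]_m :=
  diag_deriv pd r (fun k => polyCmx (pi k)) v +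
    'X^2 *: (polyCmx (cycle_step d r pi) *m v) + 'X^4 *: (polyCmx (short_step d r pi) *m v).

Let T_bounded : exists b, forall k i j e, (b <= e)%N -> (iter k T 1%:M i j)`_e = 0.
Proof.
have pdM := map_poly_derivM dM; have pdX := map_poly_derivXn dM.
(* The parameter [t] is [X^(r+2)], in accordance with the gauge weights. *)
have [| | |Phi [Psi [PP dPhi]]] := @uniton_extended_solution _ pd pdM m N
   (fun j => polyCmx (alpha j)) (fun j => polyCmx (A j)) 'X^(r.+2) (pdX _).
- by rewrite A0 map_mx0.
- by move=> j; rewrite AS map_mxB pd_polyCmx.
- move=> j /alphaP[h1 h2 h3]; rewrite pd_polyCmx -(map_mx1 (@polyC K)) -map_mxB -!map_mxM.
  by rewrite h1 h2 h3 map_mx0.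
pose g := \sum_(i < r.+2) 'X^(frame_weight r i) *: polyCmx (pi i).
(* Complementary weights: [2 r] is the largest value of [frame_weight], so [g'] inverts [g] up to
   the factor [X^(2 r)]. *)
pose g' := \sum_(i < r.+2) 'X^(2 * r - frame_weight r i) *: polyCmx (pi i).
have pp := polyCmx_frame.1.
have g'g : g' *m g = 'X^(2 * r)%:M.
  rewrite -scalemx1 -polyCmx_frame.2 scaler_sumr /g' mulmx_suml; apply: eq_bigr => i _.
  rewrite /g mulmx_sumr (bigD1 i) //= -scalemxAl -scalemxAr pp // eqxx scalerA -exprD subnK.
    rewrite big1 ?addr0 // => j ji; rewrite -scalemxAl -scalemxAr pp //.
    by case: eqP => [/val_inj ij|]; rewrite ?scaler0 //; rewrite ij eqxx in ji.
  by rewrite /frame_weight; case: ifP => i0; lia.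
apply: (@iter_gauge_bounded _ d _ (Phi *m g) (g' *m Psi) (2 * r + r.+2 * N)).
  rewrite mulmxA -(mulmxA g') PP mul_mx_scalar -scalemxAl g'g -exprM.
  by rewrite scale_scalar_mx -exprD addnC.
move=> v; rewrite -[RHS]/(map_mx pd _) -!mulmxA (map_mx_derivM pdM) dPhi.
rewrite -scalemxAl -mulmxA scalemxAr -mulmxDr; congr (_ *m _).
have := frame_gauge pdM polyCmx_frame polyCmx_cyclic r_gt0 v pdX; rewrite /= -/g => gauge.
rewrite [RHS]addrC AN map_mxB !map_mxM map_mxB map_mx1 -pd_polyCmx [RHS]gauge.
have cE : cycle_step pd r (fun k => polyCmx (pi k)) = polyCmx (cycle_step d r pi).
  rewrite /cycle_step polyCmx_block map_mxD (raddf_sum (map_mx (@polyC K))).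
  by congr (_ + _); apply: eq_bigr => i _; rewrite polyCmx_block.
by rewrite cE [short_step pd _ _]polyCmx_block.
Qed.

Lemma frame_return_nilpotent n :
  (forall j, (j < n)%N ->
    short_step d r pi *m iter j (mulmx (cycle_step d r pi)) (short_step d r pi) = 0) ->
  exists p, iter p (fun x => short_step d r pi *m iter n (mulmx (cycle_step d r pi)) x)
     (short_step d r pi) = 0.
Proof.
move=> aCa; have [b Tb] := T_bounded.
have iterC j (x y : 'M[K]_m) : iter j (mulmx (cycle_step d r pi)) (x *m y) =
     iter j (mulmx (cycle_step d r pi)) x *m y.
  by elim: j => //= j ->; rewrite mulmxA.
(* [T] contains only even powers of [X]; reading off the coefficient of index [2 e] gives [nabla],
   [C], [a] the degrees 0, 1, 2 expected by [path_rounds]. *)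
pose u k e := cf (2 * e) (iter k T 1%:M).
(* After [b] rounds the word is a coefficient of index [2 (2 + b (n + 2))], beyond the bound [b]. *)
exists b.
have cfT k e : (b <= e)%N -> cf e (iter k T 1%:M) = 0.
  by move=> be; apply/matrixP => i j; rewrite [LHS]mxE [RHS]mxE; apply: Tb.
have u00 : u 0%N 0%N = 1%:M.
  by apply/matrixP => i j; rewrite !mxE /= coefMn coef1.
rewrite -[X in iter b _ X]mulmx1 -u00.
have := @path_rounds _ (diag_deriv d r pi) (mulmx (cycle_step d r pi))
  (mulmx (short_step d r pi)) n u.
move=> <-.
- by apply: cfT; lia.
- by rewrite /diag_deriv big1 // => i _; rewrite mulmx0 map_mx0 mulmx0.
- move=> [|e] // _; apply/matrixP => i j; rewrite !mxE /= coefMn coef1 /=.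
  by rewrite mul0rn.
- move=> k e; rewrite /u iterS -/(T _) {1}/T !cfD; congr (_ + _ + _).
  + rewrite /cf /diag_deriv (raddf_sum (map_mx (coefp (2 * e)))); apply: eq_bigr => i _.
    by rewrite -[LHS]/(cf _ _) cf_mul cf_deriv cf_mul.
  + rewrite cf_shift; case: e => [|e] //; rewrite ltnNge ifN; last by lia.
    by rewrite cf_mul; congr (_ *m cf _ _); lia.
  + rewrite cf_shift; case: e => [|[|e]] //; rewrite ltnNge ifN; last by lia.
    by rewrite cf_mul; congr (_ *m cf _ _); lia.
- by move=> j x jn; rewrite /= iterC mulmxA aCa // mul0mx.
Qed.
End Unitons.

End FrameNilpotent.

(** * Gauss transforms over a differential ring *)

Section ProjectionDerivative.
Variables (K : comNzRingType) (d : {additive K -> K}).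
Hypothesis dM : forall x y, d (x * y) = d x * y + x * d y.
Variables (m : nat) (P : 'M[K]_m).
Local Notation D := (map_mx d).
Hypothesis PP : P *m P = P.

Lemma deriv_idem : D P = D P *m P + P *m D P.
Proof. by rewrite -(map_mx_derivM dM) PP. Qed.

Lemma deriv_idem_compl : D P *m (1%:M - P) = P *m D P.
Proof. by rewrite mulmxBr mulmx1 {1}deriv_idem addrC addKr. Qed.

Lemma compl_deriv_idem : (1%:M - P) *m D P = D P *m P.
Proof. by rewrite mulmxBl mul1mx {1}deriv_idem addrK. Qed.

Lemma idem_deriv_idem : P *m D P *m P = 0.
Proof. by rewrite -deriv_idem_compl -mulmxA mulmxBl mul1mx PP subrr mulmx0. Qed.

Lemma compl_deriv_compl : (1%:M - P) *m D P *m (1%:M - P) = 0.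
Proof. by rewrite compl_deriv_idem -mulmxA mulmxBr mulmx1 PP subrr mulmx0. Qed.
End ProjectionDerivative.

Section Reflection.
Variables (K : comNzRingType) (m : nat).
Implicit Types P A B : 'M[K]_m.

Lemma reflection_sqr P : P *m P = P ->
  (P - (1%:M - P)) *m (P - (1%:M - P)) = 1%:M.
Proof.
move=> PP.
have Pc : P *m (1%:M - P) = 0 by rewrite mulmxBr mulmx1 PP subrr.
have cP : (1%:M - P) *m P = 0 by rewrite mulmxBl mul1mx PP subrr.
have cc : (1%:M - P) *m (1%:M - P) = 1%:M - P by rewrite mulmxBr mulmx1 cP subr0.
have Pc1 : P + (1%:M - P) = 1%:M by rewrite addrC subrK.
move: (1%:M - P) Pc cP cc Pc1 => c Pc cP cc Pc1.
by rewrite mulmxBl !mulmxBr PP Pc cP cc subr0 sub0r opprK.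
Qed.

(** Used with [B] the derivative of [P]: multiplication by the reflection of a uniton changes [A_z]
    into [A_z - B]. *)
Lemma reflection_conj P A B : A *m P = P *m (A - B) ->
  A *m (P - (1%:M - P)) + B = (P - (1%:M - P)) *m (A - B).
Proof.
move=> e; rewrite !opprB !addrA mulmxBr mulmxDr mulmxBl mulmxDl mulmx1 mul1mx -e.
by rewrite opprB addrA [in RHS]addrAC.
Qed.
End Reflection.

Section HarmonicSequence.
Variables (K : comNzRingType) (d db : {additive K -> K}) (cj : {rmorphism K -> K}).
Hypothesis dM : forall x y, d (x * y) = d x * y + x * d y.
Hypothesis dbM : forall x y, db (x * y) = db x * y + x * db y.
Hypothesis cj_d : forall x, cj (d x) = db (cj x).
Hypothesis cj_db : forall x, cj (db x) = d (cj x).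
Hypothesis d_db : forall x, d (db x) = db (d x).
Variable m : nat.
Implicit Types P Q S X : 'M[K]_m.
Local Notation D := (map_mx d).
Local Notation Db := (map_mx db).

Definition adj (M : 'M[K]_m) : 'M[K]_m := map_mx cj M^T.

Lemma adjM P Q : adj (P *m Q) = adj Q *m adj P.
Proof. by rewrite /adj trmx_mul map_mxM. Qed.
Lemma adjB P Q : adj (P - Q) = adj P - adj Q.
Proof. by rewrite /adj raddfB /= map_mxB. Qed.
Lemma adj0 : adj 0 = 0.
Proof. by rewrite /adj trmx0 map_mx0. Qed.
Lemma adj1 : adj 1%:M = 1%:M.
Proof. by rewrite /adj trmx1 map_mx1. Qed.
Lemma adjD P : adj (D P) = Db (adj P).
Proof. by apply/matrixP => i j; rewrite !mxE cj_d. Qed.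
Lemma adjDb P : adj (Db P) = D (adj P).
Proof. by apply/matrixP => i j; rewrite !mxE cj_db. Qed.

Definition is_proj P : Prop := P *m P = P /\ adj P = P.

Definition del_sff P : 'M[K]_m := (1%:M - P) *m D P *m P.

Lemma del_sffE P : P *m P = P -> del_sff P = D P *m P.
Proof. by move=> PP; rewrite /del_sff (compl_deriv_idem dM PP) -mulmxA PP. Qed.

(** One off-diagonal block of [D (Db P)] is enough: the two derivations commute, so [D (Db P)] is
    self-adjoint when [P] is, and the opposite block is the adjoint of this one. *)
Definition harmonic_proj P : Prop := (1%:M - P) *m D (Db P) *m P = 0.

(* The second clause says that [del_sff P] maps onto [Q] on a dense set. *)
Definition gauss_image P Q : Prop :=
  Q *m del_sff P = del_sff P /\ forall X, X *m del_sff P = 0 -> X *m Q = 0.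

Lemma proj_orthC P Q : is_proj P -> is_proj Q -> P *m Q = 0 -> Q *m P = 0.
Proof. by move=> [_ hP] [_ hQ] PQ; rewrite -hP -hQ -adjM PQ adj0. Qed.

Section Step.
Variables P Q : 'M[K]_m.
Hypotheses (hP : is_proj P) (hQ : is_proj Q) (PQ : gauss_image P Q) (harmP : harmonic_proj P).

Lemma gauss_orth : P *m Q = 0.
Proof. by apply: PQ.2; rewrite /del_sff !mulmxA mulmxBr mulmx1 hP.1 subrr !mul0mx. Qed.

Let QP : Q *m P = 0.
Proof. exact: proj_orthC gauss_orth. Qed.

Let Y := 1%:M - Q - P.
Let YQ : Y *m Q = 0.
Proof. by rewrite !mulmxBl mul1mx hQ.1 subrr gauss_orth subrr. Qed.
Let YP : Y *m P = 0.
Proof. by rewrite !mulmxBl mul1mx QP subr0 hP.1 subrr. Qed.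
Let Yc : Y *m (1%:M - P) = Y.
Proof. by rewrite mulmxBr mulmx1 YP subr0. Qed.

Let YDP : Y *m D P = 0.
Proof.
rewrite (deriv_idem dM hP.1) mulmxDr [Y *m (P *m _)]mulmxA YP mul0mx addr0.
by rewrite -(del_sffE hP.1) -PQ.1 mulmxA YQ mul0mx.
Qed.

(** Apply [Db] to [Q A = A], where [A = del_sff P]. Harmonicity of [P] and [YDP] give
    [Y (Db A) = 0], and [A] is then cancelled on the right. Geometrically, [Db] of a section of [Q]
    stays in [P + Q]. *)
Lemma gauss_delbar : (1%:M - Q - P) *m Db Q *m Q = 0.
Proof.
apply: PQ.2; rewrite -/Y; have := congr1 (fun X => Y *m Db X) PQ.1.
rewrite /= (map_mx_derivM dbM) mulmxDr [Y *m (Q *m _)]mulmxA YQ mul0mx addr0 mulmxA => ->.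
rewrite (del_sffE hP.1) (map_mx_derivM dbM) mulmxDr !mulmxA YDP mul0mx addr0.
have -> : Db (D P) = D (Db P) by apply/matrixP => i j; rewrite !mxE d_db.
by rewrite -Yc -!mulmxA (mulmxA (1%:M - P)) harmP mulmx0.
Qed.

(** The product [(Db Q) Q] is [-b], where [b = P (Db P)] is the adjoint of [del_sff P]. Applying [D]
    to this identity transfers the harmonicity of [P], in its adjoint form, to [Q]. *)
Lemma gauss_harmonic : harmonic_proj Q.
Proof.
have PDbP : P *m Db P = Db P *m Q.
  have e : Q *m D P = D P *m P.
    rewrite [in LHS](deriv_idem dM hP.1) mulmxDr [Q *m (P *m _)]mulmxA QP mul0mx addr0.
    by rewrite -(del_sffE hP.1); exact: PQ.1.
  by have := congr1 adj e; rewrite !adjM adjD hP.2 hQ.2 => ->.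
pose b := P *m Db P.
have DbQ : Db Q *m Q = - b.
  have -> : Db Q *m Q = (Y + P + Q) *m (Db Q *m Q) by rewrite subrK subrK mul1mx.
  rewrite 2!mulmxDl !mulmxA gauss_delbar (idem_deriv_idem dbM hQ.1) add0r addr0.
  have := congr1 Db gauss_orth; rewrite map_mx0 (map_mx_derivM dbM) => /eqP.
  rewrite addrC addr_eq0 => /eqP ->; by rewrite mulNmx -mulmxA hQ.1 /b PDbP.
have Pb : P *m b = b by rewrite /b mulmxA hP.1.
have YDb : Y *m D b = 0.
  by rewrite -Pb (map_mx_derivM dM) mulmxDr !mulmxA YDP YP !mul0mx addr0.
have PDb : P *m D b *m Q = 0.
  rewrite {1}/b (map_mx_derivM dM) mulmxDr mulmxDl !mulmxA hP.1 -!mulmxA -PDbP.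
  rewrite [D P *m _]mulmxA [P *m (_ *m _)]mulmxA (mulmxA P (D P)) (idem_deriv_idem dM hP.1).
  rewrite mul0mx add0r.
  have Qc : (1%:M - P) *m Q = Q by rewrite mulmxBl mul1mx gauss_orth subr0.
  have := congr1 adj harmP; rewrite !adjM adjD adjDb adjB adj1 hP.2 adj0 => h.
  rewrite -Qc (mulmxA _ (1%:M - P)) mulmxA.
  have -> : D (Db P) = Db (D P) by apply/matrixP => i j; rewrite !mxE d_db.
  by rewrite h mul0mx.
have cDb : (1%:M - Q) *m D b *m Q = 0.
  rewrite -(subrK P (1%:M - Q)) mulmxDl YDb add0r; exact: PDb.
have := congr1 (fun X => (1%:M - Q) *m D X *m Q) DbQ.
rewrite /= (map_mx_derivM dM) map_mxN mulmxN mulNmx cDb oppr0 mulmxDr mulmxDl.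
rewrite -!mulmxA hQ.1 -(compl_deriv_idem dM hQ.1) (mulmxA (Db Q)) (mulmxA (1%:M - Q) (Db Q *m _)).
by rewrite (mulmxA (1%:M - Q) (Db Q)) (compl_deriv_compl dbM hQ.1) mul0mx addr0 mulmxA.
Qed.

(** By [gauss_delbar], [S (Db Q) Q = 0], with adjoint [Q (D Q) S = 0]; differentiating [Q S = 0]
    moves the derivative from [Q] to [S]. *)
Lemma gauss_block_orth S : is_proj S -> S *m P = 0 -> S *m Q = 0 -> Q *m D S *m S = 0.
Proof.
move=> hS SP SQ; have QS := proj_orthC hS hQ SQ.
have SY : S *m Y = S by rewrite !mulmxBr mulmx1 SP SQ !subr0.
have e : S *m Db Q *m Q = 0 by rewrite -SY -!mulmxA (mulmxA Y) gauss_delbar mulmx0.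
have := congr1 adj e; rewrite !adjM adjDb hS.2 hQ.2 adj0 => e'.
have := congr1 D QS; rewrite map_mx0 (map_mx_derivM dM) => /eqP; rewrite addrC addr_eq0 => /eqP h.
by rewrite -{1}hQ.1 -(mulmxA Q Q) h mulmxN mulNmx -mulmxA -mulmxA hS.1 e' oppr0.
Qed.
End Step.

End HarmonicSequence.

(** * Return maps as words in the steps of the cycle *)

Section ReturnMaps.
Variables (K : comNzRingType) (d db : {additive K -> K}) (cj : {rmorphism K -> K}).
Hypothesis dM : forall x y, d (x * y) = d x * y + x * d y.
Hypothesis dbM : forall x y, db (x * y) = db x * y + x * db y.
Hypothesis cj_d : forall x, cj (d x) = db (cj x).
Hypothesis cj_db : forall x, cj (db x) = d (cj x).
Hypothesis d_db : forall x, d (db x) = db (d x).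
Variables (m r : nat) (pi : nat -> 'M[K]_m).
Local Notation D := (map_mx d).

Fixpoint del_chain (k : nat) : 'M[K]_m :=
  if k is k'.+1 then del_sff d (pi k') *m del_chain k' else pi 0%N.

Definition return1 : 'M[K]_m := block d pi 0 r *m del_chain r.
Definition return2 : 'M[K]_m :=
  block d pi 0 r.+1 *m block d pi r.+1 r *m del_chain r.

Hypothesis r_gt0 : (0 < r)%N.
Hypothesis pi_proj : forall i, (i <= r)%N -> is_proj cj (pi i).
Hypothesis harm0 : harmonic_proj d db (pi 0%N).
Hypothesis pi_gauss : forall i, (i < r)%N -> gauss_image d (pi i) (pi i.+1).
Hypothesis pi0_orth : forall j, (0 < j <= r)%N -> pi 0%N *m pi j = 0.
Hypothesis pi_last : pi r.+1 = 1%:M - \sum_(i < r.+1) pi i.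

Let harm i : (i <= r)%N -> harmonic_proj d db (pi i).
Proof.
elim: i => // i IH ir.
by apply: (gauss_harmonic dM dbM cj_d cj_db d_db (pi_proj (ltnW ir)) (pi_proj ir)
  (pi_gauss ir) (IH (ltnW ir))).
Qed.

Let block_orth i j S : (i < r)%N -> j = i.+1 -> is_proj cj S -> S *m pi i = 0 -> S *m pi j = 0 ->
  pi j *m D S *m S = 0.
Proof.
move=> ir -> hS S1 S2.
exact: (gauss_block_orth dM dbM cj_db d_db (pi_proj (ltnW ir)) (pi_proj ir)
  (pi_gauss ir) (harm (ltnW ir)) hS S1 S2).
Qed.

(** Induction on the smaller index, started by the isotropy of [phi]. For [i + 1 < j], the bundle
    [pi i] is orthogonal to [pi (j-1)] and [pi j], so by [gauss_block_orth] its form [A'] has no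
    component in [pi j]; cancelling [A'] makes [pi (i+1)] orthogonal to [pi j]. *)
Lemma gauss_sequence_orth i j : (i <= r)%N -> (j <= r)%N -> i != j -> pi i *m pi j = 0.
Proof.
wlog: i j / (i < j)%N => [H ir jr ij|].
  have [lt|lt|e] := ltngtP i j; last by rewrite e eqxx in ij.
    exact: H.
  apply: (proj_orthC (pi_proj jr) (pi_proj ir)); apply: H => //.
  by rewrite eq_sym.
elim: i j => [|i IH] j ij ir jr _; first by rewrite pi0_orth // ij.
have orth k : (i < k <= r)%N -> pi i *m pi k = 0.
  by move=> /andP[ik kr]; apply: IH => //; [exact: ltnW | rewrite ltn_eqF].
apply: (proj_orthC (pi_proj jr) (pi_proj ir)); apply: (pi_gauss ir).2.
have ji : pi j *m pi i = 0.
  by apply: (proj_orthC (pi_proj (ltnW ir)) (pi_proj jr)); rewrite orth // jr ltnW.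
rewrite (del_sffE dM (pi_proj (ltnW ir)).1) mulmxA.
case: j ij jr ji => [//|j] ij jr ji.
apply: (@block_orth j) => //; first exact: pi_proj (ltnW ir).
  by apply: orth; rewrite -ltnS ij ltnW.
by apply: orth; rewrite jr ltnW.
Qed.

Lemma return_frame : is_frame r pi.
Proof.
have sum_pi j : (j <= r)%N -> (\sum_(i < r.+1) pi i) *m pi j = pi j.
  move=> jr; rewrite mulmx_suml (bigD1 (Ordinal (jr : (j < r.+1)%N))) //= (pi_proj jr).1.
  rewrite big1 ?addr0 // => i ij; rewrite gauss_sequence_orth //; first by rewrite -ltnS.
have pi_sum j : (j <= r)%N -> pi j *m (\sum_(i < r.+1) pi i) = pi j.
  move=> jr; rewrite mulmx_sumr (bigD1 (Ordinal (jr : (j < r.+1)%N))) //= (pi_proj jr).1.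
  rewrite big1 ?addr0 // => i ij; rewrite gauss_sequence_orth 1?eq_sym //; by rewrite -ltnS.
have last_pi j : (j <= r)%N -> pi r.+1 *m pi j = 0.
  by move=> jr; rewrite pi_last mulmxBl mul1mx sum_pi // subrr.
have pi_last0 j : (j <= r)%N -> pi j *m pi r.+1 = 0.
  by move=> jr; rewrite pi_last mulmxBr mulmx1 pi_sum // subrr.
split=> [i j ir jr|]; last by rewrite big_ord_recr /= pi_last addrC subrK.
move: ir; rewrite ltnS leq_eqVlt => /orP[/eqP ->|ir];
  move: jr; rewrite ltnS leq_eqVlt => /orP[/eqP ->|jr].
- rewrite eqxx {2}pi_last mulmxBr mulmx1 mulmx_sumr big1 ?subr0 // => k _.
  by rewrite last_pi // -ltnS.
- by rewrite gtn_eqF // last_pi.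
- by rewrite ltn_eqF // pi_last0.
- by case: eqP => [->|/eqP ij]; [rewrite (pi_proj jr).1 | rewrite gauss_sequence_orth].
Qed.

Let fr := return_frame.

Let pi_last_proj : is_proj cj (pi r.+1).
Proof.
split; first by rewrite fr.1 // eqxx.
rewrite pi_last adjB adj1; congr (_ - _); rewrite /adj.
rewrite raddf_sum (raddf_sum (map_mx cj)) /=; apply: eq_bigr => i _.
by apply: (pi_proj _).2; rewrite -ltnS.
Qed.

Let pi_proj' i : (i < r.+2)%N -> is_proj cj (pi i).
Proof. by rewrite ltnS leq_eqVlt => /orP[/eqP ->|/pi_proj]. Qed.

(** From [i < r] the form [A'] takes values in [pi (i+1)]. From [r] or [r + 1] to a target
    [0 < j <= r], [gauss_block_orth] applies, as [pi i] is orthogonal to [pi (j-1)] and [pi j]. *)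
Lemma return_cyclic : cyclic_frame d r pi.
Proof.
have orth i j : (i < r.+2)%N -> (j < r.+2)%N -> i != j -> pi i *m pi j = 0.
  by move=> ir jr ij; rewrite fr.1 // (negbTE ij).
have image i j : (i < r)%N -> (j < r.+2)%N -> j != i -> j != i.+1 -> block d pi j i = 0.
  move=> ir jr ji ji1; have ir1 : (i.+1 < r.+2)%N by rewrite ltnS leqW.
  have ir2 : (i < r.+2)%N by exact: ltnW.
  rewrite /block -mulmxA -(del_sffE dM (pi_proj (ltnW ir)).1) -(pi_gauss ir).1 mulmxA.
  by rewrite orth // mul0mx.
move=> i j ir jr ij ji1 nj.
have [ri|ri] := ltnP i r; first by apply: image; rewrite // eq_sym.
case: j jr ij ji1 nj => [|j] jr ij ji1 nj; first by rewrite ri in nj.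
have jr' : (j.+1 < r.+1)%N by move: jr ij ji1; lia.
apply: (@block_orth j) => //; first exact: pi_proj'.
  by apply: orth => //; [exact: ltnW | rewrite -eqSS eq_sym].
exact: orth.
Qed.

Lemma del_sff_block k : (k < r)%N -> del_sff d (pi k) = block d pi k.+1 k.
Proof.
move=> kr; rewrite -(pi_gauss kr).1 (del_sffE dM (pi_proj (ltnW kr)).1) mulmxA //.
Qed.

Let pi_chain k : (k <= r)%N -> pi k *m del_chain k = del_chain k.
Proof.
case: k => [|k] kr /=; first by rewrite (pi_proj _).1.
by rewrite mulmxA (pi_gauss kr).1.
Qed.

(** The factors [A'] of the chain are cancelled one after the other by the second clause of
    [gauss_image]. *)
Let cancel_chain k (X : 'M[K]_m) : (k <= r)%N -> X *m del_chain k = 0 -> X *m pi k = 0.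
Proof.
elim: k X => [|k IH] X kr //=.
rewrite mulmxA => /(IH _ (ltnW kr)).
rewrite -mulmxA /del_sff -mulmxA (pi_proj (ltnW kr)).1 => h.
exact: (pi_gauss kr).2.
Qed.

Let C := cycle_step d r pi.
Let a := short_step d r pi.

Let iterCM j (x y : 'M[K]_m) : iter j (mulmx C) (x *m y) = iter j (mulmx C) x *m y.
Proof. by elim: j => //= j ->; rewrite mulmxA. Qed.

Let iterC_chain k : (k <= r)%N -> iter k (mulmx C) (pi 0%N) = del_chain k.
Proof.
elim: k => [|k IH] kr //=; rewrite IH ?(ltnW kr) // -{1}pi_chain ?(ltnW kr) // mulmxA.
by rewrite (mul_cycle_step d fr (leqW (leqW kr))) (ltnW kr) del_sff_block.
Qed.

Let iterC_last : iter r.+1 (mulmx C) (pi 0%N) = block d pi r.+1 r *m del_chain r.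
Proof.
rewrite iterS iterC_chain // -{1}pi_chain // mulmxA (mul_cycle_step d fr) ?leqnn //.
Qed.

Let iterC_return : iter r.+2 (mulmx C) (pi 0%N) = return2.
Proof.
have e : block d pi r.+1 r = pi r.+1 *m block d pi r.+1 r.
  by rewrite (mul_pi_block d fr) ?eqxx.
rewrite iterS iterC_last [LHS](mulmxA C (block _ _ _ _)) e (mulmxA C) (mul_cycle_step d fr) //.
by rewrite ltnn.
Qed.

Let pi0_return2 : pi 0%N *m return2 = return2.
Proof. by rewrite /return2 2!mulmxA (mul_pi_block d fr). Qed.

Let pi0_returns t (x : 'M[K]_m) : pi 0%N *m x = x -> pi 0%N *m (return2 ^+ t *m x) = return2 ^+ t *m x.
Proof.
case: t => [|t] x0; first by rewrite expr0 mul1mx x0.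
by rewrite exprS -mulmxE -[return2 *m _ *m x]mulmxA mulmxA pi0_return2.
Qed.

Let iterC_returns t (x : 'M[K]_m) : pi 0%N *m x = x ->
  iter (t * r.+2) (mulmx C) x = return2 ^+ t *m x.
Proof.
move=> x0; elim: t => [|t IH]; first by rewrite expr0 mul1mx.
rewrite mulSn iterD IH -(pi0_returns t x0) iterCM iterC_return.
by rewrite exprS -mulmxE mulmxA.
Qed.

Let pi0_a : pi 0%N *m a = a.
Proof. by rewrite /a /short_step (mul_pi_block d fr). Qed.

Let pi0_return1 : pi 0%N *m return1 = return1.
Proof. by rewrite /return1 mulmxA (mul_pi_block d fr). Qed.

Let a_pi i : (i < r.+2)%N -> i != r -> a *m pi i = 0.
Proof.
by move=> ir inr; rewrite (mul_short_step d fr) // (negbTE inr).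
Qed.

Let a_pir : a *m pi r = a.
Proof. by rewrite (mul_short_step d fr) // eqxx. Qed.

(** Starting in [phi], the word [C^i] ends in the bundle of index [i], and [a] is nonzero only on
    index [r]. *)
Let a_chain i (x : 'M[K]_m) : (i < r.+2)%N -> pi 0%N *m x = x ->
  a *m iter i (mulmx C) x = if i == r then return1 *m x else 0.
Proof.
move=> ir x0; rewrite -{1}x0 iterCM.
have [ilr|ilr] := leqP i r.
  rewrite iterC_chain // mulmxA; case: eqP => [-> //|/eqP inr].
  by rewrite -pi_chain // (mulmxA a) a_pi // mul0mx mul0mx.
have -> : i = r.+1 by apply/eqP; rewrite eqn_leq ilr -ltnS ir.
have e : block d pi r.+1 r = pi r.+1 *m block d pi r.+1 r.
  by rewrite (mul_pi_block d fr) ?eqxx.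
by rewrite gtn_eqF // iterC_last e !(mulmxA a) a_pi ?gtn_eqF // !mul0mx.
Qed.

Section Nilpotent.
Variables (N : nat) (alpha A : nat -> 'M[K]_m).
Hypothesis A0 : A 0%N = 0.
Hypothesis AS : forall j, A j.+1 = A j - D (alpha j).
Hypothesis alphaP : forall j, (j < N)%N -> [/\ alpha j *m alpha j = alpha j,
      (1%:M - alpha j) *m A j *m alpha j = 0 &
      alpha j *m A j *m (1%:M - alpha j) = alpha j *m D (alpha j)].
Hypothesis AN : A N = pi 0%N *m D (pi 0%N) - (1%:M - pi 0%N) *m D (pi 0%N).

Lemma return_nilpotent s :
  (forall t, (t < s)%N -> return1 *m return2 ^+ t *m return1 = 0) ->
  exists p, (return1 *m return2 ^+ s) ^+ p = 0.
Proof.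
(* Starting in [phi], [s] full turns of the cycle and [r] further steps end in [G^(r)], where [a]
   applies; so [a C^n] is [c e^s] on [phi]. *)
move=> ret0; pose n := (s * r.+2 + r)%N.
(* The rightmost [c] is [a] times the chain; cancelling the chain turns [c e^t c = 0] into
   [c e^t a = 0]. *)
have ret_a t : (t < s)%N -> return1 *m return2 ^+ t *m a = 0.
  move=> ts; rewrite -a_pir mulmxA; apply: cancel_chain => //.
  by rewrite -mulmxA; exact: ret0.
have aCa j : (j < n)%N -> a *m iter j (mulmx C) a = 0.
  (* Divide [j] by the length [r + 2] of the cycle: [a C^j a] vanishes unless the remainder is [r],
     and in that case the quotient is less than [s]. *)
  move=> jn; rewrite (divn_eq j r.+2) addnC iterD iterC_returns //.
  rewrite a_chain ?ltn_mod //; last exact: pi0_returns.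
  case: eqP => // jr; rewrite mulmxA ret_a //.
  by move: jn; rewrite /n {1}(divn_eq j r.+2) jr ltn_add2r ltn_mul2r => /andP[].
have [p ap] := frame_return_nilpotent dM fr return_cyclic r_gt0 A0 AS alphaP AN aCa.
have pi0x q (x : 'M[K]_m) : pi 0%N *m x = x ->
    pi 0%N *m ((return1 *m return2 ^+ s) ^+ q *m x) = (return1 *m return2 ^+ s) ^+ q *m x.
  have : pi 0%N *m (return1 *m return2 ^+ s) = return1 *m return2 ^+ s.
    by rewrite mulmxA pi0_return1.
  move: (return1 *m return2 ^+ s) => Z pZ.
  case: q => [|q] x0; first by rewrite expr0 mul1mx.
  by rewrite exprS -mulmxE -(mulmxA Z) (mulmxA _ Z) pZ.
have ap' q : (return1 *m return2 ^+ s) ^+ q *m a = iter q (fun x => a *m iter n (mulmx C) x) a.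
  elim: q => [|q IH]; first by rewrite expr0 mul1mx.
  rewrite iterS -IH /n addnC iterD iterC_returns ?pi0x //.
  rewrite a_chain ?pi0_returns ?pi0x // ?leqW // eqxx.
  by rewrite exprS -mulmxE -mulmxA [RHS]mulmxA.
(* The additional factor puts an [a] to the right of the first [p] factors, where [ap] applies. *)
exists p.+1; rewrite exprSr -mulmxE [X in _ *m X](_ : _ = a *m (del_chain r *m return2 ^+ s)).
  by rewrite mulmxA ap' ap mul0mx.
by rewrite mulmxA.
Qed.
End Nilpotent.

End ReturnMaps.

(** * Smooth functions on plane domains *)

Section PartialDerivatives.
Variable R : realType.
Implicit Types (f g : R[i] -> R[i]) (v z : R[i]) (V : set R[i]).

Lemma continuous_real_complex : continuous (fun t : R => t%:C : R[i]^o).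
Proof.
move=> t; apply/cvgrPdist_lt => e e0.
have [E e'0] : e = (complex.Re e)%:C /\ 0 < complex.Re e.
  by move: e0; rewrite ltcE /= => /andP[/eqP h ?]; split=> //; apply/eqP; rewrite eq_complex /= h !eqxx.
near=> u; rewrite -raddfB /= normc_def /= expr0n addr0 sqrtr_sqr E ltcR.
by near: u; apply: cvgr_dist_lt.
Unshelve. all: by end_near. Qed.

Lemma continuous_line z v : {for 0, continuous (fun t : R => z + t%:C * v : R[i]^o)}.
Proof.
apply: (@cvgD _ R[i]^o); first exact: cvg_cst.
apply: (@cvgMl _ _ _ _ (fun t : R => t%:C : R[i]^o)); exact: continuous_real_complex.
Qed.

Lemma near_line V z v : open (V : set R[i]^o) -> V z ->
  \forall t \near (0 : R), V (z + t%:C * v).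
Proof.
move=> oV Vz; have := @continuous_line z v; rewrite /prop_for /continuous_at mul0r addr0.
by move=> /(_ V); apply; apply: open_nbhs_nbhs; split.
Qed.

Definition has_pderiv v f z (d : R[i]) : Prop :=
  is_derive (0 : R) 1 (fun t : R => complex.Re (f (z + t%:C * v))) (complex.Re d) /\
  is_derive (0 : R) 1 (fun t : R => complex.Im (f (z + t%:C * v))) (complex.Im d).

Lemma pderivableP v f z : pderivable v f z -> has_pderiv v f z (pderiv v f z).
Proof. by case=> dr di; split; rewrite /= derive1E; exact: derivableP. Qed.

Lemma has_pderivE v f z d : has_pderiv v f z d -> pderiv v f z = d.
Proof. by case=> dr di; rewrite /pderiv !derive1E !derive_val; case: d {dr di}. Qed.

Lemma has_pderivable v f z d : has_pderiv v f z d -> pderivable v f z.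
Proof. by case=> [[h1 _] [h2 _]]. Qed.

Lemma has_pderiv_cst v c z : has_pderiv v (cst c) z 0.
Proof. by split; apply: is_derive_cst. Qed.

Lemma has_pderivD v f g z df dg : has_pderiv v f z df -> has_pderiv v g z dg ->
  has_pderiv v (f \+ g) z (df + dg).
Proof.
move=> [fr fi] [gr gi]; split; rewrite raddfD.
  by under eq_fun do rewrite /= raddfD; apply: is_deriveD.
by under eq_fun do rewrite /= raddfD; apply: is_deriveD.
Qed.

Lemma has_pderiv_conj v f z df : has_pderiv v f z df ->
  has_pderiv v (fun w => conjc (f w)) z (conjc df).
Proof.
have Rec (x : R[i]) : complex.Re (conjc x) = complex.Re x by case: x.
have Imc (x : R[i]) : complex.Im (conjc x) = - complex.Im x by case: x.
move=> [fr fi]; split; rewrite ?Rec ?Imc.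
  by under eq_fun do rewrite Rec.
by under eq_fun do rewrite Imc; apply: is_deriveN.
Qed.

Lemma has_pderivM v f g z df dg : has_pderiv v f z df -> has_pderiv v g z dg ->
  has_pderiv v (fun w => f w * g w) z (df * g z + f z * dg).
Proof.
have z0 : z + (0 : R)%:C * v = z by rewrite mul0r addr0.
have ReM (x y : R[i]) : complex.Re (x * y) =
  complex.Re x * complex.Re y - complex.Im x * complex.Im y by case: x; case: y.
have ImM (x y : R[i]) : complex.Im (x * y) =
  complex.Re x * complex.Im y + complex.Im x * complex.Re y by case: x; case: y.
have ReD (x y : R[i]) : complex.Re (x + y) = complex.Re x + complex.Re y by case: x; case: y.
have ImD (x y : R[i]) : complex.Im (x + y) = complex.Im x + complex.Im y by case: x; case: y.
move=> [fr fi] [gr gi]; split.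
  under eq_fun do rewrite ReM.
  apply: is_derive_eq; rewrite z0 ReD !ReM /GRing.scale /=; ring.
under eq_fun do rewrite ImM.
apply: is_derive_eq; rewrite z0 ImD !ImM /GRing.scale /=; ring.
Qed.

Lemma has_pderiv_local V v f g z d : open (V : set R[i]^o) -> V z ->
  (forall w, V w -> f w = g w) -> has_pderiv v f z d -> has_pderiv v g z d.
Proof.
move=> oV Vz fg [dr di]; split; [move: dr | move: di]; apply: near_eq_is_derive;
  by apply: filterS (@near_line V z v oV Vz) => t /fg ->.
Qed.

Lemma pderiv_local V v f g z : open (V : set R[i]^o) -> V z ->
  (forall w, V w -> f w = g w) -> pderivable v f z -> pderiv v f z = pderiv v g z.
Proof.
move=> oV Vz fg /pderivableP df.
by rewrite (has_pderivE (has_pderiv_local oV Vz fg df)).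
Qed.
End PartialDerivatives.

Section Smooth.
Variable R : realType.
Implicit Types (f g : R[i] -> R[i]) (v z : R[i]) (V : set R[i]).

Lemma continuous_at_local V f g z : open (V : set R[i]^o) -> V z ->
  (forall w, V w -> f w = g w) -> {for z, continuous (f : R[i]^o -> R[i]^o)} ->
  {for z, continuous (g : R[i]^o -> R[i]^o)}.
Proof.
move=> oV Vz fg cf; rewrite /prop_for /continuous_at -(fg z Vz).
have fg' : \forall w \near nbhs (z : R[i]^o), f w = g w.
  by apply: filterS (open_nbhs_nbhs (conj oV Vz)) => w /fg.
exact: cvg_trans (near_eq_cvg fg') cf.
Qed.

Lemma Ck_cont k V f z : Ck k V f -> V z -> {for z, continuous (f : R[i]^o -> R[i]^o)}.
Proof. by case: k => [|k] [cf _]; apply: cf. Qed.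

Lemma Ck_pderivable k V f z v : v = 1 \/ v = 'i -> Ck k.+1 V f -> V z -> pderivable v f z.
Proof. by move=> [->|->] [_ [d _]] /d[]. Qed.

Lemma Ck_pderiv k V f v : v = 1 \/ v = 'i -> Ck k.+1 V f -> Ck k V (pderiv v f).
Proof. by move=> [->|->] [_ [_ []]]. Qed.

Lemma CkS k V f :
  (forall z, V z -> {for z, continuous (f : R[i]^o -> R[i]^o)}) ->
  (forall v, v = 1 \/ v = 'i -> (forall z, V z -> pderivable v f z) /\ Ck k V (pderiv v f)) ->
  Ck k.+1 V f.
Proof.
move=> cf H; have [d1 c1] := H 1 (or_introl erefl); have [d2 c2] := H 'i (or_intror erefl).
by split=> //; split=> [z Vz|]; split; auto.
Qed.

(** [Ck] looks only at points of the open set [V], so a function may be replaced by its extension by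
    zero. *)
Lemma Ck_local k V f g : open (V : set R[i]^o) ->
  (forall w, V w -> f w = g w) -> Ck k V f -> Ck k V g.
Proof.
move=> oV; elim: k f g => [|k IH] f g fg Cf.
  by split=> // z Vz; apply: (continuous_at_local oV Vz fg); apply: (Ck_cont Cf Vz).
apply: CkS => [z Vz|v vP].
  by apply: (continuous_at_local oV Vz fg); apply: (Ck_cont Cf Vz).
have df z : V z -> has_pderiv v f z (pderiv v f z).
  by move=> Vz; apply: pderivableP; apply: (Ck_pderivable vP Cf Vz).
split=> [z Vz|]; first by apply: has_pderivable (has_pderiv_local oV Vz fg (df z Vz)).
apply: IH (Ck_pderiv vP Cf) => w Vw.
by apply: (pderiv_local oV Vw fg); apply: (Ck_pderivable vP Cf Vw).
Qed.

(** The product rule pairs a derivative with an undifferentiated factor, which has to be brought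
    down to the same order. *)
Lemma Ck_pred k V f : Ck k.+1 V f -> Ck k V f.
Proof.
elim: k f => [|k IH] f Cf; first by split=> // z Vz; apply: (Ck_cont Cf Vz).
apply: CkS => [z Vz|v vP]; first exact: (Ck_cont Cf Vz).
split=> [z Vz|]; first exact: (Ck_pderivable vP Cf Vz).
by apply: IH; apply: Ck_pderiv vP Cf.
Qed.

Lemma Ck_cst k V c : Ck k V (cst c).
Proof.
elim: k c => [|k IH] c; first by split=> // z _; exact: (@cst_continuous R[i]^o R[i]^o c z).
apply: CkS => [z _|v _]; first exact: (@cst_continuous R[i]^o R[i]^o c z).
split=> [z _|]; first exact: has_pderivable (has_pderiv_cst v c z).
rewrite (_ : pderiv v (cst c) = cst 0) //.
by apply/funext => z; apply: has_pderivE; apply: has_pderiv_cst.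
Qed.

Lemma continuous_conjc : continuous (@conjc R : R[i]^o -> R[i]^o).
Proof.
move=> z; apply/(@cvgrPdist_lt R[i] R[i]^o R[i]^o (nbhs (z : R[i]^o)) _ conjc) => e e0.
apply/(@nbhs_ballP _ R[i]^o); exists e => //= u; rewrite /ball /= => zu.
suff -> : `|conjc z - conjc u| = `|z - u| by [].
by rewrite -raddfB /= -[conjc _]/(Num.conj _) norm_conjC.
Qed.

Lemma Ck_conj k V f : open (V : set R[i]^o) -> Ck k V f -> Ck k V (fun w => conjc (f w)).
Proof.
move=> oV; elim: k f => [|k IH] f Cf.
  split=> // z Vz; apply: (@continuous_comp R[i]^o R[i]^o R[i]^o f (@conjc R));
    [exact: (Ck_cont Cf Vz) | exact: continuous_conjc].
apply: CkS => [z Vz|v vP].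
  by apply: (@continuous_comp R[i]^o R[i]^o R[i]^o f (@conjc R));
    [exact: (Ck_cont Cf Vz) | exact: continuous_conjc].
have df z : V z -> has_pderiv v (fun w => conjc (f w)) z (conjc (pderiv v f z)).
  by move=> Vz; apply: has_pderiv_conj; apply: pderivableP; apply: (Ck_pderivable vP Cf Vz).
split=> [z Vz|]; first by apply: has_pderivable (df z Vz).
by apply: (Ck_local oV _ (IH _ (Ck_pderiv vP Cf))) => w Vw; rewrite (has_pderivE (df w Vw)).
Qed.

Lemma continuous_atD f g z : {for z, continuous (f : R[i]^o -> R[i]^o)} ->
  {for z, continuous (g : R[i]^o -> R[i]^o)} ->
  {for z, continuous (f \+ g : R[i]^o -> R[i]^o)}.
Proof. exact: (@cvgD _ R[i]^o _ (nbhs (z : R[i]^o)) _ f g (f z) (g z)). Qed.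

Lemma continuous_atM f g z : {for z, continuous (f : R[i]^o -> R[i]^o)} ->
  {for z, continuous (g : R[i]^o -> R[i]^o)} ->
  {for z, continuous ((fun w => f w * g w) : R[i]^o -> R[i]^o)}.
Proof. exact: (@cvgM _ _ (nbhs (z : R[i]^o)) _ f g (f z) (g z)). Qed.

Lemma Ck_add k V f g : open (V : set R[i]^o) -> Ck k V f -> Ck k V g -> Ck k V (f \+ g).
Proof.
move=> oV; elim: k f g => [|k IH] f g Cf Cg.
  by split=> // z Vz; exact: (continuous_atD (Ck_cont Cf Vz) (Ck_cont Cg Vz)).
apply: CkS => [z Vz|v vP].
  by exact: (continuous_atD (Ck_cont Cf Vz) (Ck_cont Cg Vz)).
have df z : V z -> has_pderiv v (f \+ g) z (pderiv v f z + pderiv v g z).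
  move=> Vz; exact: (has_pderivD (pderivableP (Ck_pderivable vP Cf Vz))
    (pderivableP (Ck_pderivable vP Cg Vz))).
split=> [z Vz|]; first by apply: has_pderivable (df z Vz).
apply: (Ck_local oV _ (IH _ _ (Ck_pderiv vP Cf) (Ck_pderiv vP Cg))) => w Vw.
by rewrite (has_pderivE (df w Vw)).
Qed.

Lemma Ck_mul k V f g : open (V : set R[i]^o) -> Ck k V f -> Ck k V g ->
  Ck k V (fun w => f w * g w).
Proof.
move=> oV; elim: k f g => [|k IH] f g Cf Cg.
  by split=> // z Vz; exact: (continuous_atM (Ck_cont Cf Vz) (Ck_cont Cg Vz)).
apply: CkS => [z Vz|v vP].
  by exact: (continuous_atM (Ck_cont Cf Vz) (Ck_cont Cg Vz)).
have df z : V z -> has_pderiv v (fun w => f w * g w) z (pderiv v f z * g z + f z * pderiv v g z).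
  move=> Vz; exact: (has_pderivM (pderivableP (Ck_pderivable vP Cf Vz))
    (pderivableP (Ck_pderivable vP Cg Vz))).
split=> [z Vz|]; first by apply: has_pderivable (df z Vz).
have Cfg := Ck_add oV (IH _ _ (Ck_pderiv vP Cf) (Ck_pred Cg)) (IH _ _ (Ck_pred Cf) (Ck_pderiv vP Cg)).
by apply: (Ck_local oV _ Cfg) => w Vw; rewrite (has_pderivE (df w Vw)).
Qed.

Lemma Cinfty_dz V f : open (V : set R[i]^o) -> Cinfty V f -> Cinfty V (dz f).
Proof.
move=> oV Cf k.
have C1 := Ck_pderiv (or_introl erefl) (Cf k.+1); have C2 := Ck_pderiv (or_intror erefl) (Cf k.+1).
have := Ck_mul oV (Ck_cst k V 2%:R^-1) (Ck_add oV C1 (Ck_mul oV (Ck_cst k V (- 'i)) C2)).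
by apply: (Ck_local oV) => w _; rewrite /dz /= mulNr.
Qed.

Lemma Cinfty_dzbar V f : open (V : set R[i]^o) -> Cinfty V f -> Cinfty V (dzbar f).
Proof.
move=> oV Cf k.
have C1 := Ck_pderiv (or_introl erefl) (Cf k.+1); have C2 := Ck_pderiv (or_intror erefl) (Cf k.+1).
have := Ck_mul oV (Ck_cst k V 2%:R^-1) (Ck_add oV C1 (Ck_mul oV (Ck_cst k V 'i) C2)).
exact: Ck_local.
Qed.

Lemma dz_local V f g z : open (V : set R[i]^o) -> V z -> (forall w, V w -> f w = g w) ->
  Cinfty V f -> dz f z = dz g z.
Proof.
move=> oV Vz fg Cf; have C1 := Cf 1%N; rewrite /dz.
rewrite (pderiv_local oV Vz fg (Ck_pderivable (or_introl erefl) C1 Vz)).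
by rewrite (pderiv_local oV Vz fg (Ck_pderivable (or_intror erefl) C1 Vz)).
Qed.

Lemma dzbar_local V f g z : open (V : set R[i]^o) -> V z -> (forall w, V w -> f w = g w) ->
  Cinfty V f -> dzbar f z = dzbar g z.
Proof.
move=> oV Vz fg Cf; have C1 := Cf 1%N; rewrite /dzbar.
rewrite (pderiv_local oV Vz fg (Ck_pderivable (or_introl erefl) C1 Vz)).
by rewrite (pderiv_local oV Vz fg (Ck_pderivable (or_intror erefl) C1 Vz)).
Qed.

End Smooth.

(** * Equality of mixed partial derivatives *)

Section Schwarz.
Variable R : realType.
Implicit Types (f : R[i] -> R[i]) (u v z p : R[i]) (V : set R[i]).

Lemma near_square (P : set R[i]) u v z : `|u| = 1 -> `|v| = 1 -> nbhs (z : R[i]^o) P ->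
  exists2 h : R, 0 < h & forall x y : R, 0 <= x <= h -> 0 <= y <= h ->
    P (z + x%:C * u + y%:C * v).
Proof.
move=> u1 v1 /(@nbhs_ballP _ R[i]^o)[e /= e0 eP].
move: e0; rewrite ltcE /= => /andP[/eqP ei er].
have Ee : e = (complex.Re e)%:C by apply/eqP; rewrite eq_complex /= ei !eqxx.
(* Two displacements of at most a third of the radius stay strictly inside the ball. *)
exists (complex.Re e / 3%:R) => [|x y /andP[x0 xh] /andP[y0 yh]]; first by rewrite divr_gt0.
apply: eP; rewrite -ball_normE /ball_ /= -addrA opprD addNKr normrN.
apply: le_lt_trans (ler_normD _ _) _; rewrite !normrM u1 v1 !mulr1 Ee.
have nC (t : R) : 0 <= t -> `|t%:C| = t%:C.
  by move=> t0; rewrite ger0_norm // lecR.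
rewrite !nC // -raddfD /= ltcR.
by lra.
Qed.

Section Component.
Variable phi : {additive R[i] -> R}.
Hypothesis phi_deriv : forall v f z d, has_pderiv v f z d ->
  is_derive (0 : R) 1 (fun t : R => phi (f (z + t%:C * v))) (phi d).
Hypothesis phi_norm : forall w : R[i], `|phi w|%:C <= `|w|.

Lemma line_derive v f p (x : R) : pderivable v f (p + x%:C * v) ->
  is_derive x 1 (fun t : R => phi (f (p + t%:C * v))) (phi (pderiv v f (p + x%:C * v))).
Proof.
move=> /pderivableP/phi_deriv d0.
have -> : (fun t : R => phi (f (p + t%:C * v))) =
   (fun t : R => phi (f (p + x%:C * v + t%:C * v))) \o (fun t => t - x).
  apply/funext => t /=; congr (phi (f _)); rewrite raddfB /=; ring.
have d1 : is_derive x 1 (fun t : R => t - x) 1.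
  by apply: is_derive_eq; rewrite subr0.
rewrite -[phi (pderiv _ _ _)]mulr1.
apply: is_derive1_comp; by rewrite subrr.
Qed.

Lemma MVT_from0 (g dg : R -> R) (h : R) : 0 < h ->
  (forall x, 0 <= x <= h -> is_derive x 1 g (dg x)) ->
  exists2 x, 0 <= x <= h & g h - g 0 = h * dg x.
Proof.
move=> h0 H.
have [x|x|c] := @MVT R g dg 0 h h0.
- by rewrite in_itv /= => /andP[x0 xh]; apply: H; rewrite !ltW.
- apply: derivable_within_continuous => y; rewrite in_itv /= => yh.
  by case: (H y yh).
rewrite in_itv /= => /andP[c0 ch] ->; exists c; first by rewrite !ltW.
by rewrite subr0 mulrC.
Qed.

(* The second difference does not change when [u] and [v] are exchanged, up to a permutation of its
   terms. *)
Lemma square_mean V u v f z (h : R) : 0 < h ->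
  (forall w, V w -> pderivable u f w) -> (forall w, V w -> pderivable v (pderiv u f) w) ->
  (forall x y : R, 0 <= x <= h -> 0 <= y <= h -> V (z + x%:C * u + y%:C * v)) ->
  exists x y : R, [/\ 0 <= x <= h, 0 <= y <= h &
    phi (f (z + h%:C * v + h%:C * u)) - phi (f (z + h%:C * u))
      - (phi (f (z + h%:C * v)) - phi (f z)) =
    h * (h * phi (pderiv v (pderiv u f) (z + x%:C * u + y%:C * v)))].
Proof.
move=> h0 df ddf Vsq; have h00 : 0 <= (0 : R) <= h by rewrite lexx ltW.
have hh : 0 <= h <= h by rewrite lexx ltW.
pose psi (x : R) := phi (f (z + h%:C * v + x%:C * u)) - phi (f (z + x%:C * u)).
have [x xh e1] : exists2 x, 0 <= x <= h & psi h - psi 0 = h *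
    (phi (pderiv u f (z + h%:C * v + x%:C * u)) - phi (pderiv u f (z + x%:C * u))).
  apply: MVT_from0 h0 _ => x xh; apply: is_deriveB; apply: line_derive; apply: df.
    by rewrite -addrA [X in z + X]addrC addrA; apply: Vsq.
  by have := Vsq x 0 xh h00; rewrite mul0r addr0.
have [y yh e2] : exists2 y, 0 <= y <= h &
    phi (pderiv u f (z + x%:C * u + h%:C * v)) - phi (pderiv u f (z + x%:C * u + 0%:C * v)) =
      h * phi (pderiv v (pderiv u f) (z + x%:C * u + y%:C * v)).
  apply: (@MVT_from0 (fun y : R => phi (pderiv u f (z + x%:C * u + y%:C * v)))) h0 _ => y yh.
  by apply: line_derive; apply: ddf; apply: Vsq.
exists x, y; split=> //; rewrite -e2 [z + x%:C * u + h%:C * v]addrAC mul0r addr0 -e1 /psi.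
by rewrite mul0r !addr0.
Qed.

Lemma component_continuous f z : {for z, continuous (f : R[i]^o -> R[i]^o)} ->
  forall e : R, 0 < e -> \forall w \near nbhs (z : R[i]^o), `|phi (f w) - phi (f z)| < e.
Proof.
move=> cf e e0; have e0' : (0 : R[i]) < e%:C by rewrite ltcR.
have H : nbhs (z : R[i]^o) (fun w => `|f z - f w| < e%:C).
  exact: (@cvgrPdist_lt R[i] R[i]^o R[i]^o (nbhs (z : R[i]^o)) _ f (f z)).1 cf _ e0'.
suff sub : (fun w => `|f z - f w| < e%:C) `<=` (fun w => `|phi (f w) - phi (f z)| < e).
  exact: (@filterS _ _ (nbhs_filter (z : R[i]^o)) _ _ sub H).
move=> w; rewrite distrC -raddfB -ltcR; exact: le_lt_trans.
Qed.

(** The mean value theorem needs real values, so [phi] stands for the real or the imaginary part.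
    The second difference over a small square is [h^2] times either mixed derivative at some point
    of the square. If these differed by [e] at [z], this common value would lie strictly within
    [e / 2] of both. *)
Lemma component_schwarz V f u v z : open (V : set R[i]^o) -> V z -> `|u| = 1 -> `|v| = 1 ->
  (forall w, V w -> pderivable u f w /\ pderivable v f w) ->
  (forall w, V w -> pderivable v (pderiv u f) w /\ pderivable u (pderiv v f) w) ->
  {for z, continuous (pderiv v (pderiv u f) : R[i]^o -> R[i]^o)} ->
  {for z, continuous (pderiv u (pderiv v f) : R[i]^o -> R[i]^o)} ->
  phi (pderiv v (pderiv u f) z) = phi (pderiv u (pderiv v f) z).
Proof.
move=> oV Vz u1 v1 df ddf c1 c2; apply/eqP; rewrite -subr_eq0 -normr_eq0.
apply/negPn/negP => ne0; set e := `|_| in ne0.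
have e0 : 0 < e / 2%:R by rewrite divr_gt0 // lt_neqAle eq_sym ne0 /e normr_ge0.
have near_all : nbhs (z : R[i]^o) (fun w => [/\ V w,
    `|phi (pderiv v (pderiv u f) w) - phi (pderiv v (pderiv u f) z)| < e / 2%:R &
    `|phi (pderiv u (pderiv v f) w) - phi (pderiv u (pderiv v f) z)| < e / 2%:R]).
  have := @filterI _ _ (nbhs_filter (z : R[i]^o)) _ _
    (@filterI _ _ (nbhs_filter (z : R[i]^o)) _ _ (component_continuous c1 e0) (component_continuous c2 e0))
    (open_nbhs_nbhs (conj oV Vz)).
  by apply: (@filterS _ _ (nbhs_filter (z : R[i]^o))) => w [[? ?] ?].
have [h h0 sq] := near_square u1 v1 near_all.
have [x [y [xh yh e1]]] := square_mean h0 (fun w Vw => (df w Vw).1) (fun w Vw => (ddf w Vw).1)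
  (fun x y xh yh => let: And3 Vw _ _ := sq x y xh yh in Vw).
have sq' x' y' : 0 <= x' <= h -> 0 <= y' <= h -> V (z + x'%:C * v + y'%:C * u).
  by move=> h1 h2; rewrite addrAC; case: (sq y' x' h2 h1).
have [y' [x' [yh' xh' e2]]] := square_mean h0 (fun w Vw => (df w Vw).2) (fun w Vw => (ddf w Vw).2) sq'.
have hn0 : h != 0 by rewrite gt_eqF.
have [_ b1 _] := sq x y xh yh; have [_ _ b2] := sq x' y' xh' yh'.
have eq12 : phi (pderiv v (pderiv u f) (z + x%:C * u + y%:C * v)) =
    phi (pderiv u (pderiv v f) (z + x'%:C * u + y'%:C * v)).
  have swap (a b c d : R) : a - b - (c - d) = a - c - (b - d) by ring.
  apply: (mulfI hn0); apply: (mulfI hn0).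
  rewrite [LHS](esym e1) swap [z + h%:C * v + _]addrAC e2.
  exact: (congr1 (fun w => h * (h * phi (pderiv u (pderiv v f) w))) (addrAC _ _ _)).
have b1' := eq_ind _ (fun X => `|X - phi (pderiv v (pderiv u f) z)| < e / 2%:R) b1 _ eq12.
have tri (X a b c : R) : `|X - a| < c / 2%:R -> `|X - b| < c / 2%:R -> `|a - b| < c.
  move=> Xa Xb; rewrite -(subrKA X); apply: le_lt_trans (ler_normD _ _) _.
  by rewrite distrC [ltRHS]splitr; apply: ltrD.
have lt : e < e := tri _ _ _ _ b1' b2.
by rewrite ltxx in lt.
Qed.

End Component.

Lemma pderiv_comm k V f z : open (V : set R[i]^o) -> Ck k.+2 V f -> V z ->
  pderiv 'i (pderiv 1 f) z = pderiv 1 (pderiv 'i f) z.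
Proof.
move=> oV Cf Vz.
have p1 : (1 : R[i]) = 1 \/ 1 = 'i :> R[i] by left.
have pi : ('i : R[i]) = 1 \/ 'i = 'i :> R[i] by right.
have i1 : `|'i : R[i]| = 1 by rewrite normCi.
have main (phi : {additive R[i] -> R}) :
  (forall v f z d, has_pderiv v f z d ->
    is_derive (0 : R) 1 (fun t : R => phi (f (z + t%:C * v))) (phi d)) ->
  (forall w : R[i], `|phi w|%:C <= `|w|) ->
  phi (pderiv 'i (pderiv 1 f) z) = phi (pderiv 1 (pderiv 'i f) z).
  move=> h1 h2; apply: (component_schwarz h1 h2 oV Vz (normr1 _) i1).
  - by move=> w Vw; split; [exact: (Ck_pderivable p1 Cf Vw) | exact: (Ck_pderivable pi Cf Vw)].
  - move=> w Vw; split.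
      exact: (Ck_pderivable pi (Ck_pderiv p1 Cf) Vw).
    exact: (Ck_pderivable p1 (Ck_pderiv pi Cf) Vw).
  - exact: (Ck_cont (Ck_pderiv pi (Ck_pderiv p1 Cf)) Vz).
  - exact: (Ck_cont (Ck_pderiv p1 (Ck_pderiv pi Cf)) Vz).
apply/eqP; rewrite eq_complex; apply/andP; split; apply/eqP.
  by apply: (main (@complex.Re R)) => [v g w d []//|w]; exact: normc_ge_Re.
apply: (main (@complex.Im R)) => [v g w d []//|w].
(* The bound of [Im w] by the modulus of [w] is the bound for the real part of [i w]. *)
have := normc_ge_Re (w * 'i%C); rewrite ReiNIm normrN normrM.
by rewrite -[X in `|w| * X]/(`|('i : R[i])|) i1 mulr1.
Qed.

Lemma dz_dzbar_comm V f z : open (V : set R[i]^o) -> Cinfty V f -> V z ->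
  dz (dzbar f) z = dzbar (dz f) z.
Proof.
move=> oV Cf Vz.
have p1 : (1 : R[i]) = 1 \/ 1 = 'i :> R[i] by left.
have pi : ('i : R[i]) = 1 \/ 'i = 'i :> R[i] by right.
have D v v' : v = 1 \/ v = 'i -> v' = 1 \/ v' = 'i ->
    has_pderiv v (pderiv v' f) z (pderiv v (pderiv v' f) z).
  by move=> vP vP'; apply: pderivableP; apply: (Ck_pderivable vP (Ck_pderiv vP' (Cf 2%N)) Vz).
have comb v (c : R[i]) : v = 1 \/ v = 'i ->
    pderiv v (fun w => 2%:R^-1 * (pderiv 1 f w + c * pderiv 'i f w)) z =
    2%:R^-1 * (pderiv v (pderiv 1 f) z + c * pderiv v (pderiv 'i f) z).
  move=> vP.
  have := has_pderivM (has_pderiv_cst v 2%:R^-1 z) (has_pderivD (D v _ vP p1)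
    (has_pderivM (has_pderiv_cst v c z) (D v _ vP pi))).
  by move/has_pderivE => ->; rewrite /= !mul0r !add0r.
have dzE : dz f = fun w => 2%:R^-1 * (pderiv 1 f w + - 'i * pderiv 'i f w).
  by apply/funext => w; rewrite /dz mulNr.
have alg (a b c e : R[i]) : c = b ->
    2%:R^-1 * (2%:R^-1 * (a + 'i * b) - 'i * (2%:R^-1 * (c + 'i * e))) =
    2%:R^-1 * (2%:R^-1 * (a + - 'i * b) + 'i * (2%:R^-1 * (c + - 'i * e))).
  by move=> ->; ring.
rewrite [LHS]/dz [RHS]/dzbar dzE !comb //.
exact: (alg _ _ _ _ (pderiv_comm oV (Cf 2%N) Vz)).
Qed.

End Schwarz.

(** * The differential ring of smooth functions on an open set *)

Record open_plane (R : realType) := OpenPlane {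
  plane_set :> set R[i];
  plane_open : open (plane_set : set R[i]^o) }.

Section SmoothRing.
Variables (R : realType) (V : open_plane R).

Definition smooth_pred : {pred R[i]^o -> R[i]} := fun f => `[< Cinfty V (f : R[i] -> R[i]) >].

Lemma smooth_subring : subring_closed smooth_pred.
Proof.
have oV := @plane_open _ V.
split=> [|f g /asboolP Cf /asboolP Cg|f g /asboolP Cf /asboolP Cg]; apply/asboolP => k.
- exact: Ck_cst.
- have := Ck_add oV (Cf k) (Ck_mul oV (Ck_cst k V (- 1)) (Cg k)).
  by apply: (Ck_local oV) => w _ /=; rewrite mulN1r.
- exact: (Ck_mul oV (Cf k) (Cg k)).
Qed.
HB.instance Definition _ := GRing.isSubringClosed.Build _ smooth_pred smooth_subring.

(** Elements are total functions, and equality is equality on the whole plane; identities are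
    therefore also checked off [V]. In return the ring is nonzero even when [V] is empty. *)
Record smooth_fun := SmoothFun { sf_val :> R[i]^o -> R[i]; _ : sf_val \in smooth_pred }.
HB.instance Definition _ := [isSub for sf_val].
HB.instance Definition _ := [Choice of smooth_fun by <:].
HB.instance Definition _ := [SubChoice_isSubComNzRing of smooth_fun by <:].

Lemma smooth_funP (f : smooth_fun) : Cinfty V (f : R[i] -> R[i]).
Proof. by case: f => f /= /asboolP. Qed.

Lemma smooth_fun_eq (f g : smooth_fun) : (forall w, f w = g w) -> f = g.
Proof. by move=> fg; apply: val_inj; apply/funext. Qed.

Lemma Cinfty_restrict (f : R[i] -> R[i]) : Cinfty V f ->
  Cinfty V (fun w => if `[< plane_set V w >] then f w else 0).
Proof.
move=> Cf k; apply: Ck_local (@plane_open _ V) _ (Cf k) => w Vw.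
by case: asboolP.
Qed.

(* Derivatives and bundles only make sense on [V]; they are extended by 0. *)
Definition restrict_fun (f : R[i] -> R[i]) : smooth_fun :=
  insubd (0 : smooth_fun) (fun w => if `[< plane_set V w >] then f w else 0).

Lemma restrict_funE f w : Cinfty V f -> plane_set V w -> restrict_fun f w = f w.
Proof.
move=> /Cinfty_restrict Cf Vw; rewrite /restrict_fun insubdK; last exact/asboolP.
by case: asboolP.
Qed.

Lemma restrict_fun0 f w : ~ plane_set V w -> restrict_fun f w = 0.
Proof.
move=> Vw; rewrite /restrict_fun /insubd; case: insubP => [u _ /= -> |_] //=.
by case: asboolP.
Qed.

Definition del (f : smooth_fun) : smooth_fun := restrict_fun (dz f).
Definition delbar (f : smooth_fun) : smooth_fun := restrict_fun (dzbar f).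

Lemma delE f w : plane_set V w -> del f w = dz f w.
Proof. exact: restrict_funE (Cinfty_dz (@plane_open _ V) (smooth_funP f)). Qed.
Lemma delbarE f w : plane_set V w -> delbar f w = dzbar f w.
Proof. exact: restrict_funE (Cinfty_dzbar (@plane_open _ V) (smooth_funP f)). Qed.

Let has_pd (f : smooth_fun) w v : plane_set V w -> v = 1 \/ v = 'i ->
  has_pderiv v (f : R[i] -> R[i]) w (pderiv v f w).
Proof. by move=> Vw vP; apply: pderivableP; apply: (Ck_pderivable vP (smooth_funP f 1%N) Vw). Qed.

Let pd_sub (f g : smooth_fun) w v : plane_set V w -> v = 1 \/ v = 'i ->
  pderiv v (f - g : smooth_fun) w = pderiv v f w - pderiv v g w.
Proof.
move=> Vw vP; have := has_pderivD (has_pd f Vw vP)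
  (has_pderivM (has_pderiv_cst v (- 1) w) (has_pd g Vw vP)).
rewrite mul0r add0r mulN1r => /has_pderivE <-; congr (pderiv v _ w).
by apply/funext => z; rewrite /= mulN1r.
Qed.

Let pd_mul (f g : smooth_fun) w v : plane_set V w -> v = 1 \/ v = 'i ->
  pderiv v (f * g : smooth_fun) w = pderiv v f w * g w + f w * pderiv v g w.
Proof. by move=> Vw vP; apply: has_pderivE (has_pderivM (has_pd f Vw vP) (has_pd g Vw vP)). Qed.

Let one_dir : (1 : R[i]) = 1 \/ 1 = 'i :> R[i]. Proof. by left. Qed.
Let i_dir : ('i : R[i]) = 1 \/ 'i = 'i :> R[i]. Proof. by right. Qed.

Let dz_sub (f g : smooth_fun) w : plane_set V w ->
  dz (f - g : smooth_fun) w = dz f w - dz g w.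
Proof.
have alg (p q a b c e : R[i]) : p = a - b -> q = c - e ->
  2%:R^-1 * (p - 'i * q) = 2%:R^-1 * (a - 'i * c) - 2%:R^-1 * (b - 'i * e).
  by move=> -> ->; ring.
by move=> Vw; exact: (alg _ _ _ _ _ _ (pd_sub f g Vw one_dir) (pd_sub f g Vw i_dir)).
Qed.

Let dz_mul (f g : smooth_fun) w : plane_set V w ->
  dz (f * g : smooth_fun) w = dz f w * g w + f w * dz g w.
Proof.
have alg (p q a b c e x y : R[i]) : p = a * x + y * b -> q = c * x + y * e ->
  2%:R^-1 * (p - 'i * q) = 2%:R^-1 * (a - 'i * c) * x + y * (2%:R^-1 * (b - 'i * e)).
  by move=> -> ->; ring.
by move=> Vw; exact: (alg _ _ _ _ _ _ _ _ (pd_mul f g Vw one_dir) (pd_mul f g Vw i_dir)).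
Qed.

Lemma del_is_zmod_morphism : zmod_morphism del.
Proof.
move=> f g; apply: smooth_fun_eq => w; case: (asboolP (plane_set V w)) => Vw.
  exact: (etrans (delE (f - g) Vw) (etrans (dz_sub f g Vw)
    (esym (congr2 (fun a b => a - b) (delE f Vw) (delE g Vw))))).
apply: (etrans (restrict_fun0 _ Vw)); symmetry.
by apply: (etrans (congr2 (fun a b => a - b) (restrict_fun0 _ Vw) (restrict_fun0 _ Vw))); rewrite subr0.
Qed.

Lemma delM f g : del (f * g) = del f * g + f * del g.
Proof.
apply: smooth_fun_eq => w; case: (asboolP (plane_set V w)) => Vw.
  exact: (etrans (delE (f * g) Vw) (etrans (dz_mul f g Vw)
    (esym (congr2 (fun a b => a * g w + f w * b) (delE f Vw) (delE g Vw))))).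
apply: (etrans (restrict_fun0 _ Vw)); symmetry.
apply: (etrans (congr2 (fun a b => a * g w + f w * b) (restrict_fun0 _ Vw) (restrict_fun0 _ Vw))).
by rewrite mul0r mulr0 addr0.
Qed.

Let dzbar_sub (f g : smooth_fun) w : plane_set V w ->
  dzbar (f - g : smooth_fun) w = dzbar f w - dzbar g w.
Proof.
have alg (p q a b c e : R[i]) : p = a - b -> q = c - e ->
  2%:R^-1 * (p + 'i * q) = 2%:R^-1 * (a + 'i * c) - 2%:R^-1 * (b + 'i * e).
  by move=> -> ->; ring.
by move=> Vw; exact: (alg _ _ _ _ _ _ (pd_sub f g Vw one_dir) (pd_sub f g Vw i_dir)).
Qed.

Let dzbar_mul (f g : smooth_fun) w : plane_set V w ->
  dzbar (f * g : smooth_fun) w = dzbar f w * g w + f w * dzbar g w.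
Proof.
have alg (p q a b c e x y : R[i]) : p = a * x + y * b -> q = c * x + y * e ->
  2%:R^-1 * (p + 'i * q) = 2%:R^-1 * (a + 'i * c) * x + y * (2%:R^-1 * (b + 'i * e)).
  by move=> -> ->; ring.
by move=> Vw; exact: (alg _ _ _ _ _ _ _ _ (pd_mul f g Vw one_dir) (pd_mul f g Vw i_dir)).
Qed.

Lemma delbar_is_zmod_morphism : zmod_morphism delbar.
Proof.
move=> f g; apply: smooth_fun_eq => w; case: (asboolP (plane_set V w)) => Vw.
  exact: (etrans (delbarE (f - g) Vw) (etrans (dzbar_sub f g Vw)
    (esym (congr2 (fun a b => a - b) (delbarE f Vw) (delbarE g Vw))))).
apply: (etrans (restrict_fun0 _ Vw)); symmetry.
by apply: (etrans (congr2 (fun a b => a - b) (restrict_fun0 _ Vw) (restrict_fun0 _ Vw))); rewrite subr0.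
Qed.

Lemma delbarM f g : delbar (f * g) = delbar f * g + f * delbar g.
Proof.
apply: smooth_fun_eq => w; case: (asboolP (plane_set V w)) => Vw.
  exact: (etrans (delbarE (f * g) Vw) (etrans (dzbar_mul f g Vw)
    (esym (congr2 (fun a b => a * g w + f w * b) (delbarE f Vw) (delbarE g Vw))))).
apply: (etrans (restrict_fun0 _ Vw)); symmetry.
apply: (etrans (congr2 (fun a b => a * g w + f w * b) (restrict_fun0 _ Vw) (restrict_fun0 _ Vw))).
by rewrite mul0r mulr0 addr0.
Qed.

HB.instance Definition _ := GRing.isZmodMorphism.Build smooth_fun smooth_fun del
  del_is_zmod_morphism.
HB.instance Definition _ := GRing.isZmodMorphism.Build smooth_fun smooth_fun delbar
  delbar_is_zmod_morphism.

Lemma del_delbar f : del (delbar f) = delbar (del f).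
Proof.
apply: smooth_fun_eq => w; case: (asboolP (plane_set V w)) => Vw; last by rewrite !restrict_fun0.
rewrite delE // delbarE //.
have oV := @plane_open _ V; have Cf := smooth_funP f.
rewrite (dz_local oV Vw (fun z => @delbarE f z) (smooth_funP _)).
rewrite (dzbar_local oV Vw (fun z => @delE f z) (smooth_funP _)).
exact: dz_dzbar_comm oV Cf Vw.
Qed.

Lemma conj_smooth (f : smooth_fun) : (fun w => conjc (f w)) \in smooth_pred.
Proof. by apply/asboolP => k; apply: (Ck_conj (@plane_open _ V)) (smooth_funP f k). Qed.

Definition conj_fun (f : smooth_fun) : smooth_fun := SmoothFun (conj_smooth f).

Lemma conj_fun_is_zmod_morphism : zmod_morphism conj_fun.
Proof. by move=> f g; apply: smooth_fun_eq => w /=; rewrite raddfB. Qed.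
Lemma conj_fun_is_monoid_morphism : monoid_morphism conj_fun.
Proof.
split=> [|f g]; apply: smooth_fun_eq => w /=; first exact: conjc1.
exact: rmorphM.
Qed.
HB.instance Definition _ := GRing.isZmodMorphism.Build smooth_fun smooth_fun conj_fun
  conj_fun_is_zmod_morphism.
HB.instance Definition _ := GRing.isMonoidMorphism.Build smooth_fun smooth_fun conj_fun
  conj_fun_is_monoid_morphism.

Lemma conj_del f : conj_fun (del f) = delbar (conj_fun f).
Proof.
apply: smooth_fun_eq => w; rewrite -[LHS]/(conjc (del f w)).
case: (asboolP (plane_set V w)) => Vw; last by rewrite !restrict_fun0 // conjc0.
rewrite delE // delbarE // /dz /dzbar.
have pdc v : v = 1 \/ v = 'i -> pderiv v (conj_fun f) w = conjc (pderiv v f w).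
  by move=> vP; apply: has_pderivE (has_pderiv_conj (has_pd f Vw vP)).
have alg (p q p' q' : R[i]) : p' = conjc p -> q' = conjc q ->
    conjc (2%:R^-1 * (p - 'i * q)) = 2%:R^-1 * (p' + 'i * q').
  have c2 : conjc (2%:R^-1 : R[i]) = 2%:R^-1 by rewrite fmorphV; congr (_^-1); exact: conjc_nat.
  have ci : conjc ('i : R[i]) = - 'i by exact: conjCi.
  move=> -> ->; transitivity (conjc (2%:R^-1 : R[i]) * (conjc p - conjc ('i : R[i]) * conjc q)).
    by rewrite rmorphM rmorphB rmorphM.
  by rewrite c2 ci mulNr opprK.
exact: (alg _ _ _ _ (pdc _ one_dir) (pdc _ i_dir)).
Qed.

Lemma conj_funK : involutive conj_fun.
Proof. by move=> f; apply: smooth_fun_eq => w /=; exact: conjcK. Qed.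

Lemma conj_delbar f : conj_fun (delbar f) = del (conj_fun f).
Proof. by rewrite -{1}[f]conj_funK -conj_del conj_funK. Qed.

Definition eval_at (w : R[i]) (f : smooth_fun) : R[i] := f w.

Lemma eval_at_is_zmod_morphism w : zmod_morphism (eval_at w). Proof. by []. Qed.
Lemma eval_at_is_monoid_morphism w : monoid_morphism (eval_at w). Proof. by []. Qed.
HB.instance Definition _ w := GRing.isZmodMorphism.Build smooth_fun R[i] (eval_at w)
  (eval_at_is_zmod_morphism w).
HB.instance Definition _ w := GRing.isMonoidMorphism.Build smooth_fun R[i] (eval_at w)
  (eval_at_is_monoid_morphism w).

Lemma cst_smooth (c : R[i]) : (fun _ : R[i]^o => c) \in smooth_pred.
Proof. by apply/asboolP => k; exact: Ck_cst. Qed.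
Definition cst_fun (c : R[i]) : smooth_fun := SmoothFun (cst_smooth c).

Lemma del_cst c : del (cst_fun c) = 0.
Proof.
apply: smooth_fun_eq => w; case: (asboolP (plane_set V w)) => Vw; last by rewrite restrict_fun0.
by rewrite delE // /dz !(has_pderivE (has_pderiv_cst _ c w)) mulr0 subr0 mulr0.
Qed.

Lemma eval_mx_eq m n (A B : 'M[smooth_fun]_(m, n)) :
  (forall w, map_mx (eval_at w) A = map_mx (eval_at w) B) -> A = B.
Proof.
move=> AB; apply/matrixP => a b; apply: smooth_fun_eq => w.
by have /matrixP/(_ a b) := AB w; rewrite !mxE.
Qed.

End SmoothRing.

(** * Bundles in a chart *)

Section Chart.
Variables (R : realType) (M : riemann_surface R) (i : rs_index M).

Definition chart_plane : open_plane R := OpenPlane (@cimage_open R M i).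
Local Notation K := (smooth_fun chart_plane).
Local Notation V := (plane_set chart_plane).
Local Notation ev w := (map_mx (@eval_at R chart_plane w)).

Definition chart_lift m n (psi : M -> 'M[R[i]]_(m, n)) : 'M[K]_(m, n) :=
  \matrix_(a, b) restrict_fun chart_plane (fun w => psi (param i w) a b).

Let chartV x : cdom i x -> V (chart i x). Proof. by exists x. Qed.

Lemma eval_lift m n (psi : M -> 'M[R[i]]_(m, n)) x : smooth psi -> cdom i x ->
  ev (chart i x) (chart_lift psi) = psi x.
Proof.
move=> ps ix; apply/matrixP => a b; rewrite !mxE /eval_at restrict_funE ?chartK //.
  exact: ps.
exact: chartV.
Qed.

Lemma eval_lift0 m n (psi : M -> 'M[R[i]]_(m, n)) w : ~ V w -> ev w (chart_lift psi) = 0.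
Proof. by move=> Vw; apply/matrixP => a b; rewrite !mxE /eval_at restrict_fun0. Qed.

Lemma chart_mx_eq m n (A B : 'M[K]_(m, n)) :
  (forall x, cdom i x -> ev (chart i x) A = ev (chart i x) B) ->
  (forall w, ~ V w -> ev w A = ev w B) -> A = B.
Proof.
move=> e1 e2; apply: eval_mx_eq => w.
case: (asboolP (V w)) => [[x ix <-]|Vw]; [exact: e1 | exact: e2].
Qed.

Lemma eval_del m n (F : 'M[K]_(m, n)) (psi : M -> 'M[R[i]]_(m, n)) x :
  (forall y, cdom i y -> ev (chart i y) F = psi y) -> cdom i x ->
  ev (chart i x) (map_mx (@del R chart_plane) F) = d_z i psi x.
Proof.
move=> Fpsi ix; apply/matrixP => a b; rewrite !mxE /eval_at delE; last exact: chartV.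
apply: (dz_local (@plane_open _ chart_plane) (chartV ix) _ (smooth_funP _)) => w [y iy <-].
by have /matrixP/(_ a b) := Fpsi y iy; rewrite chartK // => <-; rewrite !mxE.
Qed.

Lemma eval_delbar m n (F : 'M[K]_(m, n)) (psi : M -> 'M[R[i]]_(m, n)) x :
  (forall y, cdom i y -> ev (chart i y) F = psi y) -> cdom i x ->
  ev (chart i x) (map_mx (@delbar R chart_plane) F) = d_zbar i psi x.
Proof.
move=> Fpsi ix; apply/matrixP => a b; rewrite !mxE /eval_at delbarE; last exact: chartV.
apply: (dzbar_local (@plane_open _ chart_plane) (chartV ix) _ (smooth_funP _)) => w [y iy <-].
by have /matrixP/(_ a b) := Fpsi y iy; rewrite chartK // => <-; rewrite !mxE.
Qed.

Lemma eval_del0 m n (F : 'M[K]_(m, n)) w : ~ V w -> ev w (map_mx (@del R chart_plane) F) = 0.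
Proof. by move=> Vw; apply/matrixP => a b; rewrite !mxE /eval_at restrict_fun0. Qed.

Lemma eval_delbar0 m n (F : 'M[K]_(m, n)) w : ~ V w -> ev w (map_mx (@delbar R chart_plane) F) = 0.
Proof. by move=> Vw; apply/matrixP => a b; rewrite !mxE /eval_at restrict_fun0. Qed.

Lemma near_param x (P : M -> Prop) : cdom i x -> (\forall y \near x^', P y) ->
  nbhs (chart i x : R[i]^o)^' (fun w => V w /\ P (param i w)).
Proof.
move=> ix nP; have Vx := chartV ix.
have c := param_continuous Vx; rewrite /prop_for /continuous_at chartK // in c.
have n1 : nbhs (chart i x : R[i]^o) (fun w => param i w != x -> P (param i w)) := c _ nP.
have n2 : nbhs (chart i x : R[i]^o) V.
  by apply: open_nbhs_nbhs; split; [exact: (@plane_open _ chart_plane) | exact: Vx].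
have := @filterI _ _ (nbhs_filter (chart i x : R[i]^o)) _ _ n1 n2.
apply: (@filterS _ _ (nbhs_filter (chart i x : R[i]^o))) => w [h1 h2] wx; split=> //.
case: h2 h1 wx => y iy <-; rewrite chartK // => h1 yx; apply: h1.
by apply: contraNneq yx => ->.
Qed.

(** Punctured neighbourhoods in the plane are nonempty, so no point of the surface is isolated. *)
Lemma near_exists x (P : M -> Prop) : cdom i x -> (\forall y \near x^', P y) ->
  exists y, cdom i y /\ P y.
Proof.
move=> ix /(near_param ix) nP.
have [w [[y iy <-]]] := @filter_ex _ _ (Proper_dnbhs_regular_numFieldType (chart i x : R[i]^o)) _ nP.
by rewrite chartK // => Py; exists y.
Qed.

(** By continuity a nonzero value would persist nearby. This carries identities across the isolated
    points where zeros are filled out. *)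
Lemma vanish_near x (F : K) : cdom i x -> (\forall y \near x^', cdom i y -> F (chart i y) = 0) ->
  F (chart i x) = 0.
Proof.
move=> ix nF; apply/eqP/negPn/negP => F0; have F0' : 0 < `|F (chart i x)| by rewrite normr_gt0.
have cF := Ck_cont (smooth_funP F 0%N) (chartV ix).
have H : nbhs (chart i x : R[i]^o) (fun w => `|F (chart i x) - F w| < `|F (chart i x)|).
  exact: (@cvgrPdist_lt R[i] R[i]^o R[i]^o (nbhs (chart i x : R[i]^o)) _ F (F (chart i x))).1 cF _ F0'.
have H' : nbhs (chart i x : R[i]^o)^' (fun w => `|F (chart i x) - F w| < `|F (chart i x)|).
  by apply: (@filterS _ _ (nbhs_filter (chart i x : R[i]^o)) _ _ _ H) => w ? _.
have PF := Proper_dnbhs_regular_numFieldType (chart i x : R[i]^o).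
have := @filter_ex _ _ PF _ (@filterI _ _ PF _ _ (near_param ix nF) H').
move=> [w [[[y iy <-]]]]; rewrite chartK // => /(_ iy) ->.
by rewrite subr0 ltxx.
Qed.

Lemma vanish_near_mx m n x (F : 'M[K]_(m, n)) : cdom i x ->
  (\forall y \near x^', cdom i y -> ev (chart i y) F = 0) -> ev (chart i x) F = 0.
Proof.
move=> ix nF; apply/matrixP => a b; rewrite !mxE; apply: (vanish_near ix).
apply: filterS nF => y Fy iy; have /matrixP/(_ a b) := Fy iy; by rewrite !mxE.
Qed.

End Chart.

Section Bundles.
Variables (R : realType) (M : riemann_surface R) (i : rs_index M) (n : nat).
Local Notation K := (smooth_fun (chart_plane i)).
Local Notation V := (plane_set (chart_plane i)).
Local Notation ev w := (map_mx (@eval_at R (chart_plane i) w)).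
Local Notation D := (map_mx (@del R (chart_plane i))).
Local Notation Db := (map_mx (@delbar R (chart_plane i))).
Local Notation cj := (@conj_fun R (chart_plane i)).
Implicit Types (psi chi : M -> 'M[R[i]]_n).

Lemma eval_adj (A : 'M[K]_n) w : ev w (adj cj A) = (ev w A)^t*.
Proof. by apply/matrixP => a b; rewrite !mxE. Qed.

Lemma subbundle_smooth psi : subbundle psi -> smooth psi. Proof. by case. Qed.
Lemma subbundle_idem psi x : subbundle psi -> psi x *m psi x = psi x.
Proof. by case=> _ [k /(_ x)[]]. Qed.
Lemma subbundle_herm psi x : subbundle psi -> (psi x)^t* = psi x.
Proof. by case=> _ [k /(_ x)[]]. Qed.

Lemma lift_proj psi : subbundle psi -> is_proj cj (chart_lift i psi).
Proof.
move=> sp; have sm := subbundle_smooth sp; split; apply: chart_mx_eq => [x ix|w Vw].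
- by rewrite map_mxM eval_lift // subbundle_idem.
- by rewrite map_mxM eval_lift0 // mulmx0.
- by rewrite eval_adj eval_lift // subbundle_herm.
- by rewrite eval_adj eval_lift0 // trmx0 map_mx0.
Qed.

Lemma eval_del_sff psi x : smooth psi -> cdom i x ->
  ev (chart i x) (del_sff (@del R (chart_plane i)) (chart_lift i psi)) = sff_perp i psi x.
Proof.
move=> sm ix; rewrite /del_sff !map_mxM map_mxB map_mx1 eval_lift //.
by rewrite (eval_del (psi := psi)) // => y iy; rewrite eval_lift.
Qed.

Lemma mulmx_cols_eq (A B : 'M[R[i]]_n) : (forall v : 'cV[R[i]]_n, A *m v = B *m v) -> A = B.
Proof.
move=> AB; apply/matrixP => a b; have /matrixP/(_ a ord0) := AB (delta_mx b 0).
by rewrite -!colE !mxE.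
Qed.

(** Near each point, except possibly at the point itself, [chi] is the image of [A'_psi]. There the
    projection onto [chi] fixes [A'_psi], and whatever kills [A'_psi] on the left kills [chi]; both
    identities extend by continuity. *)
Lemma fills_gauss_image psi chi : subbundle psi -> fills_image psi chi ->
  gauss_image (@del R (chart_plane i)) (chart_lift i psi) (chart_lift i chi).
Proof.
move=> sp [sc fill]; have sm := subbundle_smooth sp; have smc := subbundle_smooth sc.
split=> [|X X0].
  apply: chart_mx_eq => [x ix|w Vw]; last first.
    by rewrite !map_mxM !(eval_lift0 psi Vw) !mulmx0.
  apply/eqP; rewrite -subr_eq0 -map_mxB; apply/eqP; apply: (vanish_near_mx ix).
  apply: filterS (fill i x ix) => y fy iy; rewrite map_mxB map_mxM eval_lift // eval_del_sff //.
  apply/eqP; rewrite subr_eq0; apply/eqP; apply: mulmx_cols_eq => v.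
  have : space (chi y) (sff_perp i psi y *m v).
    rewrite fy; exists (psi y *m v); first by rewrite /space /= mulmxA subbundle_idem.
    by rewrite /sff_perp /sff -!mulmxA (mulmxA (psi y)) subbundle_idem.
  by rewrite /space /= mulmxA.
apply: chart_mx_eq => [x ix|w Vw]; last by rewrite map_mxM eval_lift0 // mulmx0 map_mx0.
rewrite map_mx0; apply: (vanish_near_mx ix).
apply: filterS (fill i x ix) => y fy iy; rewrite map_mxM eval_lift //.
apply: mulmx_cols_eq => v; rewrite mul0mx -mulmxA.
have : space (chi y) (chi y *m v) by rewrite /space /= mulmxA subbundle_idem.
rewrite fy => -[u _ <-]; rewrite mulmxA -eval_del_sff // -map_mxM X0 map_mx0 mul0mx //.
Qed.

End Bundles.

(** * Existence of the Gauss transforms up to the isotropy order *)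

Section GaussTransforms.
Variables (R : realType) (M : riemann_surface R) (n : nat).
Implicit Types (phi psi chi : M -> 'M[R[i]]_n).

(** The rank is constant, so it suffices that [chi] vanishes at one point, which the image condition
    provides. *)
Lemma fills_image0 chi : fills_image (fun _ => 0) chi -> chi = (fun _ => 0).
Proof.
move=> [[sc [k gk]] fill]; apply/funext => x.
have [i ix] := cdom_cover x.
have [y [iy fy]] := near_exists ix (fill i x ix).
have chiy : chi y = 0.
  apply: mulmx_cols_eq => v; rewrite mul0mx.
  have : space (chi y) (chi y *m v).
    by rewrite /space /= mulmxA; case: (gk y) => ->.
  by rewrite fy => -[u _ <-]; rewrite /sff_perp /sff mulmx0 mul0mx.
have k0 : k = 0%N by case: (gk y) => _ _ <-; rewrite chiy mxrank0.
by apply/eqP; rewrite -mxrank_eq0; case: (gk x) => _ _ ->; rewrite k0.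
Qed.

Lemma gauss_transform0 : gauss_transform (fun _ : M => 0 : 'M[R[i]]_n) = (fun _ => 0).
Proof.
rewrite /gauss_transform; case: xgetP => [chi -> /= fill|//].
exact: fills_image0.
Qed.

(* Were the Gauss sequence to stop at the default value 0, the isotropy order would be infinite. *)
Lemma gauss_fills phi r j : finite_isotropy_order phi r -> (j < r)%N ->
  fills_image (gauss j phi) (gauss j.+1 phi).
Proof.
move=> [r1 iso maxr] jr.
case: (pselect (exists chi, fills_image (gauss j phi) chi)) => [[chi hchi]|none].
  exact: (xgetPex (fun _ => 0) (P := [set chi | fills_image (gauss j phi) chi])
    (ex_intro _ chi hchi)).
have g0 : gauss j.+1 phi = fun _ => 0.
  rewrite /gauss iterS /gauss_transform; case: xgetP => [chi _ hchi|//].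
  by case: none; exists chi.
have gl l : gauss (l + j.+1) phi = fun _ => 0.
  elim: l => [|l IH]; first by rewrite add0n.
  by rewrite addSn /gauss iterS -/(gauss _ _) IH gauss_transform0.
suff /maxr : isotropic phi r.+1 by rewrite ltnn.
move=> l /andP[l1 lr] x; have [ll|ll] := leqP l r; first by apply: iso; rewrite l1.
by rewrite -(subnK (leq_trans jr (ltnW ll))) gl mulmx0.
Qed.

Lemma gauss_subbundle phi k r j : smooth phi -> (forall x, grassmannian k (phi x)) ->
  finite_isotropy_order phi r -> (j <= r)%N -> subbundle (gauss j phi).
Proof.
move=> sm gr iso; case: j => [_|j jr]; first by split=> //; exists k.
by case: (gauss_fills iso jr).
Qed.

End GaussTransforms.

(** * Harmonicity in a chart *)

Section ChartData.
Variables (R : realType) (M : riemann_surface R) (i : rs_index M) (n : nat).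
Local Notation K := (smooth_fun (chart_plane i)).
Local Notation V := (plane_set (chart_plane i)).
Local Notation ev w := (map_mx (@eval_at R (chart_plane i) w)).
Local Notation D := (map_mx (@del R (chart_plane i))).
Local Notation Db := (map_mx (@delbar R (chart_plane i))).
Local Notation cj := (@conj_fun R (chart_plane i)).
Local Notation lift := (chart_lift i).

Lemma re_trace_sq (Z : 'M[R[i]]_n) : complex.Re (\tr (Z *m Z^t*)) = 0 -> Z = 0.
Proof.
have mulc (z : R[i]) : complex.Re (z * (Num.conj z)) = complex.Re z ^+ 2 + complex.Im z ^+ 2.
  by case: z => a b; rewrite -[Num.conj _]/(conjc _) /=; ring.
rewrite /mxtrace raddf_sum /= => tr0.
have ge0 a b : 0 <= complex.Re (Z a b * Num.conj (Z a b)).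
  by rewrite mulc addr_ge0 // sqr_ge0.
have row a : complex.Re ((Z *m Z^t*) a a) = \sum_b complex.Re (Z a b * Num.conj (Z a b)).
  by rewrite mxE raddf_sum; apply: eq_bigr => b _; rewrite !mxE.
have rge0 a : 0 <= complex.Re ((Z *m Z^t*) a a) by rewrite row sumr_ge0.
apply/matrixP => a b; rewrite mxE.
have : complex.Re ((Z *m Z^t*) a a) = 0 by apply: (psumr_eq0P (P := xpredT) (fun a _ => rge0 a) tr0).
rewrite row => r0; have : complex.Re (Z a b * Num.conj (Z a b)) = 0.
  exact: (psumr_eq0P (P := xpredT) (fun b _ => ge0 a b) r0).
rewrite mulc => /eqP; rewrite paddr_eq0 ?sqr_ge0 // !sqrf_eq0 => /andP[/eqP h1 /eqP h2].
by apply/eqP; rewrite eq_complex h1 h2 !eqxx.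
Qed.

(** Let [Z = (1 - P) Y P]. Tested against the tangent vector [Z] plus its adjoint, the hypothesis
    says that twice the squared norm of [Z] is zero. *)
Lemma tension_free (P Y : 'M[R[i]]_n) : P *m P = P -> P^t* = P -> Y^t* = Y ->
  (forall X, tangent_grassmannian P X -> complex.Re (\tr (Y *m X^t*)) = 0) ->
  (1%:M - P) *m Y *m P = 0.
Proof.
move=> PP hP hY tan.
have tcM (A B : 'M[R[i]]_n) : (A *m B)^t* = B^t* *m A^t* by rewrite trmx_mul map_mxM.
have tcB (A B : 'M[R[i]]_n) : (A - B)^t* = A^t* - B^t* by rewrite raddfB /= map_mxB.
have tcD (A B : 'M[R[i]]_n) : (A + B)^t* = A^t* + B^t* by rewrite raddfD /= map_mxD.
have tc1 : (1%:M : 'M[R[i]]_n)^t* = 1%:M by rewrite trmx1 map_mx1.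
have cP : P *m (1%:M - P) = 0 by rewrite mulmxBr mulmx1 PP subrr.
have Pc : (1%:M - P) *m P = 0 by rewrite mulmxBl mul1mx PP subrr.
have cc : (1%:M - P) *m (1%:M - P) = 1%:M - P by rewrite mulmxBr mulmx1 Pc subr0.
set Z := (1%:M - P) *m Y *m P.
have ZE : Z^t* = P *m Y *m (1%:M - P) by rewrite /Z !tcM tcB tc1 hP hY mulmxA.
have ZK : Z^t*^t* = Z by rewrite trmxCK.
have ZP : Z *m P = Z by rewrite /Z -mulmxA PP.
have PZ : P *m Z = 0 by rewrite /Z !mulmxA cP !mul0mx.
have := tan (Z + Z^t*); rewrite tcD ZK [Z^t* + Z]addrC => H.
apply: re_trace_sq.
have trZ : \tr (Z *m Z^t*) = \tr ((1%:M - P) *m (Y *m P *m Y)).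
  rewrite ZE (_ : Z *m _ = Z *m Y *m (1%:M - P)); last by rewrite !mulmxA ZP.
  by rewrite mxtrace_mulC /Z !mulmxA cc.
have tr1 : \tr (Y *m Z) = \tr (Z *m Z^t*).
  by rewrite trZ mxtrace_mulC /Z !mulmxA.
have tr2 : \tr (Y *m Z^t*) = \tr (Z *m Z^t*).
  by rewrite trZ ZE !mulmxA mxtrace_mulC !mulmxA.
have : complex.Re (\tr (Y *m (Z + Z^t*))) = 0.
  apply: H; split; first by rewrite tcD ZK addrC.
  have e1 : Z^t* *m P = 0 by rewrite ZE -!mulmxA Pc !mulmx0.
  have e2 : P *m Z^t* = Z^t* by rewrite ZE !mulmxA PP.
  by rewrite mulmxDl mulmxDr ZP PZ e1 e2 addr0 add0r.
rewrite mulmxDr raddfD /= tr1 tr2 raddfD /= => /eqP.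
by rewrite -mulr2n mulrn_eq0 => /eqP.
Qed.

Lemma map_mx_del_delbar (A : 'M[K]_n) : D (Db A) = Db (D A).
Proof. by apply/matrixP => a b; rewrite !mxE; exact: del_delbar. Qed.

Lemma harmonic_lift k (phi : M -> 'M[R[i]]_n) : harmonic_grassmannian k phi ->
  harmonic_proj (@del R (chart_plane i)) (@delbar R (chart_plane i)) (lift phi).
Proof.
move=> [sm gr harm]; have sp : subbundle phi by split=> //; exists k.
apply: chart_mx_eq => [x ix|w Vw]; last by rewrite map_mxM eval_lift0 // mulmx0 map_mx0.
have evY : ev (chart i x) (D (Db (lift phi))) = d_z i (d_zbar i phi) x.
  apply: eval_del => // y iy; apply: eval_delbar => // z iz; exact: eval_lift.
rewrite !map_mxM map_mxB map_mx1 evY eval_lift // map_mx0.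
apply: tension_free; [exact: subbundle_idem | exact: subbundle_herm | | exact: harm].
rewrite -evY -eval_adj; congr (ev _ _).
rewrite (adjD (@conj_del R (chart_plane i))) (adjDb (@conj_delbar R (chart_plane i))).
rewrite (lift_proj i sp).2; exact: esym (map_mx_del_delbar _).
Qed.

End ChartData.

(** * Products of unitons and their [A_z] *)

Section UnitonFactorization.
Variables (R : realType) (M : riemann_surface R) (i : rs_index M) (n : nat).
Local Notation K := (smooth_fun (chart_plane i)).
Local Notation V := (plane_set (chart_plane i)).
Local Notation ev w := (map_mx (@eval_at R (chart_plane i) w)).
Local Notation D := (map_mx (@del R (chart_plane i))).
Local Notation Db := (map_mx (@delbar R (chart_plane i))).
Local Notation cj := (@conj_fun R (chart_plane i)).
Local Notation lift := (chart_lift i).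
Local Notation delM := (@delM R (chart_plane i)).
Local Notation delbarM := (@delbarM R (chart_plane i)).

Variables (N : nat) (phi0 : 'M[R[i]]_n) (alpha : nat -> M -> 'M[R[i]]_n).
Hypothesis phi0U : phi0 \is unitarymx.
Hypothesis alphaU : forall j, (j < N)%N -> uniton (uniton_product phi0 alpha j) (alpha j).

(** [A_z] of the partial product of [j] unitons: it is 0 for the constant [phi0], and each uniton
    subtracts its derivative; see [uniton_A_z]. *)
Definition uniton_A (j : nat) : 'M[K]_n := - \sum_(l < j) D (lift (alpha l)).

Let A := uniton_A.

Lemma uniton_A0 : A 0%N = 0.
Proof. by rewrite /A /uniton_A big_ord0 oppr0. Qed.

Lemma uniton_AS j : A j.+1 = A j - D (lift (alpha j)).
Proof. by rewrite /A /uniton_A big_ord_recr opprD. Qed.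

Fixpoint uniton_lift (j : nat) : 'M[K]_n :=
  if j is j'.+1 then uniton_lift j' *m (lift (alpha j') - (1%:M - lift (alpha j')))
  else map_mx (@cst_fun R (chart_plane i)) phi0.

Let F := uniton_lift.

(** The last clause is [A = F^-1 (D F) / 2], written without inverses. *)
Definition uniton_lift_spec (j : nat) : Prop :=
  [/\ forall x, cdom i x -> ev (chart i x) (F j) = uniton_product phi0 alpha j x,
      adj cj (F j) *m F j = 1%:M & D (F j) = (F j *m A j) *+ 2].

(** The formula for [A_zbar] comes from applying [Db] to the unitarity of [F j]. *)
Lemma uniton_A_z j x : uniton_lift_spec j -> cdom i x ->
  A_z (uniton_product phi0 alpha j) i x = ev (chart i x) (A j) /\
  A_zbar (uniton_product phi0 alpha j) i x = - (ev (chart i x) (A j))^t*.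
Proof.
move=> [Fe FF FD] ix.
have n2 : (2%:R : R[i]) != 0 by rewrite pnatr_eq0.
have Fu : uniton_product phi0 alpha j x \in unitmx.
  have := congr1 (fun X => ev (chart i x) X) FF; rewrite /= map_mxM Fe // map_mx1.
  by move=> /mulmx1_unit[].
have half (X : 'M[R[i]]_n) : 2%:R^-1 *: (X *+ 2) = X.
  by rewrite -[X *+ 2]scaler_nat scalerA mulVf // scale1r.
split.
  rewrite /A_z -(eval_del Fe ix) FD mulr2n map_mxD map_mxM Fe //.
  by rewrite mulmxDr mulKmx // -mulr2n half.
have FF' : F j *m adj cj (F j) = 1%:M by apply: mulmx1C.
have e : adj cj (F j) *m Db (F j) = - (adj cj (A j) *+ 2).
  have := congr1 (map_mx (@delbar R (chart_plane i))) FF.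
  rewrite (map_mx_derivM delbarM) (map_mx_deriv_scalar _ (deriv1 delbarM)) => /eqP.
  rewrite addrC addr_eq0 => /eqP ->; congr (- _).
  rewrite -(adjD (@conj_del R (chart_plane i))) FD !mulr2n.
  have -> (X : 'M[K]_n) : adj cj (X + X) = adj cj X + adj cj X.
    by rewrite /adj raddfD /= map_mxD.
  by rewrite adjM mulmxDl -mulmxA FF mulmx1.
have -> : A_zbar (uniton_product phi0 alpha j) i x =
    2%:R^-1 *: ev (chart i x) (adj cj (F j) *m Db (F j)).
  rewrite /A_zbar -(eval_delbar Fe ix) map_mxM; congr (_ *: (_ *m _)).
  have : ev (chart i x) (adj cj (F j)) *m uniton_product phi0 alpha j x = 1%:M.
    by rewrite -(Fe x ix) -map_mxM FF map_mx1.
  by move=> h; rewrite -[RHS]mulmx1 -(mulmxV Fu) mulmxA h mul1mx.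
by rewrite e map_mxN mulr2n map_mxD -mulr2n scalerN half eval_adj.
Qed.

Let uniton_smooth j : (j < N)%N -> subbundle (alpha j).
Proof. by move=> /alphaU[]. Qed.

(** The columns of the projection [alpha j] serve as test sections. Closure under [A_z] gives the
    second identity; closure under the delbar operator gives the third after taking adjoints,
    because [A_zbar] is minus the adjoint of [A_z]. *)
Lemma uniton_lift_conditions j : (j < N)%N -> uniton_lift_spec j ->
  let al := lift (alpha j) in
  [/\ al *m al = al, (1%:M - al) *m A j *m al = 0 &
      al *m A j *m (1%:M - al) = al *m D al].
Proof.
move=> jN spec al; have sb := uniton_smooth jN; have sm := subbundle_smooth sb.
have [alal hal] := lift_proj i sb.
have [hu _ closed] := alphaU jN.
have sect x : cdom i x ->
    alpha j x *m (d_zbar i (alpha j) x + A_zbar (uniton_product phi0 alpha j) i x *m alpha j x) =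
      d_zbar i (alpha j) x + A_zbar (uniton_product phi0 alpha j) i x *m alpha j x /\
    alpha j x *m (A_z (uniton_product phi0 alpha j) i x *m alpha j x) =
      A_z (uniton_product phi0 alpha j) i x *m alpha j x.
  move=> ix.
  have colsP b : [/\ smooth (fun y => col b (alpha j y)),
      forall y, space (alpha j y) (col b (alpha j y)) &
      d_zbar i (fun y => col b (alpha j y)) x = col b (d_zbar i (alpha j) x)].
    split.
    - move=> i' a c; rewrite (_ : (fun w => _) = fun w => alpha j (param i' w) a b); first exact: sm.
      by apply/funext => w; rewrite mxE.
    - by move=> y; rewrite /space /= colE mulmxA subbundle_idem.
    - apply/matrixP => a c; rewrite mxE [RHS]mxE [RHS]mxE.
      have -> : (fun w => col b (alpha j (param i w)) a c) = fun w => alpha j (param i w) a b.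
        by apply/funext => w; rewrite mxE.
      by [].
  have deltas (X Y : 'M[R[i]]_n) :
      (forall b, X *m delta_mx b (0 : 'I_1) = Y *m delta_mx b 0) -> X = Y.
    move=> XY; apply/matrixP => a b; have /matrixP/(_ a ord0) := XY b.
    by rewrite -!colE !mxE.
  split; apply: deltas => b; have [c1 c2 c3] := colsP b;
    have [s1 s2] := closed _ c1 c2 i x ix.
    move: s1; rewrite /space /= c3 !colE => s1.
    by rewrite -mulmxA mulmxDl -[_ *m alpha j x *m _]mulmxA.
  by move: s2; rewrite /space /= !colE -!mulmxA.
have cA : (1%:M - al) *m A j *m al = 0.
  apply: chart_mx_eq => [x ix|w Vw]; last by rewrite map_mxM eval_lift0 // mulmx0 map_mx0.
  rewrite !map_mxM map_mxB map_mx1 eval_lift // map_mx0 -(uniton_A_z spec ix).1.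
  by rewrite -mulmxA mulmxBl mul1mx (sect x ix).2 subrr.
have cB : (1%:M - al) *m (Db al - adj cj (A j) *m al) = 0.
  apply: chart_mx_eq => [x ix|w Vw]; last first.
    rewrite map_mxM !map_mxB map_mxM eval_lift0 // mulmx0 subr0 map_mx0 map_mx1 subr0 mul1mx.
    exact: eval_delbar0.
  have edb : ev (chart i x) (Db al) = d_zbar i (alpha j) x.
    by apply: eval_delbar => // y iy; rewrite eval_lift.
  rewrite !map_mxM !map_mxB map_mx1 map_mxM eval_lift // edb map_mx0 eval_adj.
  rewrite -mulNmx -(uniton_A_z spec ix).2.
  by rewrite mulmxBl mul1mx (sect x ix).1 subrr.
split=> //.
have := congr1 (fun X => adj cj X) cB; rewrite /=
adjM adj0 !adjB adj1 (adjDb (@conj_delbar R (chart_plane i))) adjM hal.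
have adjK (X : 'M[K]_n) : adj cj (adj cj X) = X.
  by apply/matrixP => a b; rewrite !mxE; exact: conj_funK.
rewrite adjK mulmxBl (deriv_idem_compl delM alal) => /eqP.
by rewrite subr_eq0 => /eqP ->.
Qed.

(** The specification at [j] yields the uniton conditions at [j], from which [reflection_conj]
    yields the specification at [j + 1]. *)
Lemma uniton_liftP j : (j <= N)%N -> uniton_lift_spec j.
Proof.
elim: j => [_|j IH jN].
  split=> [x ix||].
  - by apply/matrixP => a b; rewrite !mxE.
  - have := phi0U => /unitarymxP/mulmx1C h; apply: eval_mx_eq => w.
    rewrite map_mxM eval_adj map_mx1.
    have -> : ev w (F 0%N) = phi0 by apply/matrixP => a b; rewrite !mxE.
    exact: h.
  - rewrite uniton_A0 mulmx0 mul0rn; apply/matrixP => a b; rewrite !mxE; exact: del_cst.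
have spec := IH (ltnW jN); have [Fe FF FD] := spec.
have [alal cA cB] := uniton_lift_conditions jN spec.
have sb := uniton_smooth jN; have sm := subbundle_smooth sb.
have [_ hal] := lift_proj i sb.
split=> [x ix||].
- by rewrite /= map_mxM Fe // !map_mxB map_mx1 eval_lift.
- rewrite /= adjM !adjB adj1 hal -mulmxA (mulmxA _ (F j)) FF mul1mx.
  exact: reflection_sqr.
- rewrite uniton_AS [D (F j.+1)](map_mx_derivM delM) FD /=.
  move: (lift (alpha j)) alal cA cB => al _ cA cB.
  rewrite !map_mxB (map_mx_deriv_scalar _ (deriv1 delM)) sub0r opprK -mulr2n.
  have two (X Y : 'M[K]_n) : X *+ 2 *m Y = (X *m Y) *+ 2 by rewrite !mulr2n mulmxDl.
  have two' (X Y : 'M[K]_n) : X *m (Y *+ 2) = (X *m Y) *+ 2 by rewrite !mulr2n mulmxDr.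
  rewrite two two' -mulrnDl -[F j *m A j *m _]mulmxA -mulmxDr -mulmxA.
  congr ((_ *m _) *+ 2); apply: reflection_conj.
  rewrite mulmxBr -cB mulmxBr mulmx1 opprB addrCA subrr addr0.
  by apply/eqP; rewrite -subr_eq0 -{1}[A j]mul1mx -!mulmxBl cA.
Qed.

End UnitonFactorization.

(** * Return maps evaluated in a chart *)

Section ReturnMapsInChart.
Variables (R : realType) (M : riemann_surface R) (i : rs_index M) (n k r : nat).
Variable phi : M -> 'M[R[i]]_n.
Hypothesis harm : harmonic_grassmannian k phi.
Hypothesis iso : finite_isotropy_order phi r.

Local Notation K := (smooth_fun (chart_plane i)).
Local Notation V := (plane_set (chart_plane i)).
Local Notation ev w := (map_mx (@eval_at R (chart_plane i) w)).
Local Notation del := (@del R (chart_plane i)).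
Local Notation D := (map_mx del).
Local Notation lift := (chart_lift i).

Definition gauss_lift (j : nat) : 'M[K]_n :=
  if (j <= r)%N then lift (gauss j phi) else 1%:M - \sum_(l < r.+1) lift (gauss l phi).
Local Notation pi := gauss_lift.

Let sub_gauss j : (j <= r)%N -> subbundle (gauss j phi).
Proof. by case: harm => sm gr _ jr; apply: gauss_subbundle sm gr iso jr. Qed.

Let phi_sub : subbundle phi. Proof. exact: (@sub_gauss 0). Qed.

Let piE j : (j <= r)%N -> pi j = lift (gauss j phi).
Proof. by rewrite /pi => ->. Qed.

Let pi_last : pi r.+1 = 1%:M - \sum_(l < r.+1) pi l.
Proof.
rewrite {1}/pi ltnn; congr (_ - _); apply: eq_bigr => l _.
by rewrite piE // -ltnS.
Qed.

Let ev_pi j x : (j <= r)%N -> cdom i x -> ev (chart i x) (pi j) = gauss j phi x.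
Proof. by move=> jr ix; rewrite piE // eval_lift //; apply: subbundle_smooth (sub_gauss jr). Qed.

Let ev_last x : cdom i x -> ev (chart i x) (pi r.+1) = remainder phi r x.
Proof.
move=> ix; rewrite pi_last map_mxB map_mx1 /remainder big_mkord.
rewrite (raddf_sum (map_mx (@eval_at R (chart_plane i) (chart i x)))); congr (_ - _).
by apply: eq_bigr => l _; rewrite -[LHS]/(ev (chart i x) (pi l)) ev_pi // -ltnS.
Qed.

Let ev_block (psi chi : M -> 'M[R[i]]_n) a b x :
  (forall y, cdom i y -> ev (chart i y) (pi a) = psi y) ->
  (forall y, cdom i y -> ev (chart i y) (pi b) = chi y) -> cdom i x ->
  ev (chart i x) (block del pi b a) = sff i psi chi x.
Proof. by move=> h1 h2 ix; rewrite /block !map_mxM h1 // h2 // (eval_del h1). Qed.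

Let ev_chain j x : (j <= r)%N -> cdom i x ->
  ev (chart i x) (del_chain del pi j) = sff_chain i phi j x.
Proof.
elim: j => [|j IH] jr ix /=; first exact: (@ev_pi 0).
rewrite map_mxM IH ?(ltnW jr) // piE ?(ltnW jr) // eval_del_sff //.
exact: subbundle_smooth (sub_gauss (ltnW jr)).
Qed.

Let ev_return1 x : cdom i x -> ev (chart i x) (return1 del r pi) = first_return phi r i x.
Proof.
move=> ix; rewrite /return1 map_mxM ev_chain //.
rewrite (ev_block (psi := gauss r phi) (chi := phi)) // => y iy; first exact: ev_pi.
exact: (@ev_pi 0).
Qed.

Let ev_return2 x : cdom i x -> ev (chart i x) (return2 del r pi) = second_return phi r i x.
Proof.
move=> ix; rewrite /return2 2!map_mxM ev_chain //.
have e0 y : cdom i y -> ev (chart i y) (pi 0) = phi y := @ev_pi 0 y isT.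
have er y : cdom i y -> ev (chart i y) (pi r) = gauss r phi y := @ev_pi r y (leqnn r).
by rewrite (ev_block ev_last e0 ix) (ev_block er ev_last ix).
Qed.

Let ev_exp w (X : 'M[K]_n) t : ev w (X ^+ t) = (ev w X) ^+ t.
Proof.
elim: t => [|t IH]; first by rewrite !expr0 [LHS](map_mx1 (@eval_at R (chart_plane i) w)).
by rewrite !exprS -mulmxE map_mxM IH.
Qed.

Let chain_phi j x : (j <= r)%N -> sff_chain i phi j x *m phi x = sff_chain i phi j x.
Proof.
elim: j => [|j IH] jr /=; first exact: subbundle_idem.
by rewrite -mulmxA IH // ltnW.
Qed.

(** The hypotheses are carried over to the ring of smooth functions on the chart image, where
    [return_nilpotent] applies; its conclusion is evaluated at [x]. *)
Lemma return_D_nilpotent_at (alpha : M -> 'M[R[i]]_n) s x :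
  finite_uniton_number phi ->
  (forall y, cdom i y ->
    mulmx (first_return phi r i y) @` space (phi y) `<=` space (alpha y)) ->
  (forall y, cdom i y ->
    space (alpha y) `<=` [set v | first_return phi r i y *m v = 0]) ->
  (forall t, (1 <= t < s)%N -> power_zero_on alpha (return_D phi r t) 1) ->
  cdom i x -> exists p, return_D phi r s i x ^+ p = 0.
Proof.
move=> [N [phi0 [al [phi0U alU phiE]]]] im_c ker_c Dt0 ix.
have r1 : (0 < r)%N by case: iso.
(* Let [S] be the reflection in [phi]. Then [D S] is twice [D phi], and, for [S] as a product of
   unitons, twice [S A]; since [S^2 = 1], [A = S (D phi)]. *)
have AN : uniton_A i al N = pi 0%N *m D (pi 0%N) - (1%:M - pi 0%N) *m D (pi 0%N).
  have sm := subbundle_smooth phi_sub; rewrite piE // -mulmxBl.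
  apply: chart_mx_eq => [y iy|w Vw]; last first.
    rewrite map_mxM eval_del0 // mulmx0 /uniton_A map_mxN.
    rewrite (raddf_sum (map_mx (@eval_at R (chart_plane i) w))) big1 ?oppr0 // => l _.
    exact: eval_del0.
  have [Fe _ FD] := uniton_liftP i phi0U alU (leqnn N).
  have e2 z : cdom i z -> ev (chart i z) (lift phi - (1%:M - lift phi)) = uniton_product phi0 al N z.
    by move=> iz; rewrite !map_mxB map_mx1 eval_lift // -phiE.
  pose q := ev (chart i y) (D (lift phi)); pose a := ev (chart i y) (uniton_A i al N).
  have lhs : ev (chart i y) (D (uniton_lift i phi0 al N)) = q + q.
    apply: etrans (eval_del Fe iy) (etrans (esym (eval_del e2 iy)) _).
    have -> : D (lift phi - (1%:M - lift phi)) = D (lift phi) + D (lift phi).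
      by rewrite !map_mxB (map_mx_deriv_scalar _ (deriv1 (@delM R (chart_plane i)))) sub0r opprK.
    exact: map_mxD.
  have rhs : ev (chart i y) ((uniton_lift i phi0 al N *m uniton_A i al N) *+ 2) =
      ((phi y - (1%:M - phi y)) *m a) *+ 2.
    by rewrite mulr2n map_mxD map_mxM Fe // -phiE.
  have e : q + q = ((phi y - (1%:M - phi y)) *m a) *+ 2 by rewrite -lhs FD rhs.
  have -> : ev (chart i y) ((lift phi - (1%:M - lift phi)) *m D (lift phi)) =
      (phi y - (1%:M - phi y)) *m q.
    by rewrite map_mxM !map_mxB map_mx1 eval_lift.
  have sq := reflection_sqr (subbundle_idem y phi_sub).
  rewrite -/a; move: q a (phi y - (1%:M - phi y)) sq e {lhs rhs} => q a S sq e.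
  have : (S *m q) *+ 2 = a *+ 2.
    by rewrite !mulr2n -mulmxDr e mulr2n mulmxDr !mulmxA sq mul1mx.
  move/eqP; rewrite -subr_eq0 -mulrnBl => /eqP/matrixP h.
  apply/matrixP => b c; have := h b c; rewrite !mulr2n !mxE -mulr2n => /eqP.
  by rewrite mulrn_eq0 /= subr_eq0 => /eqP.
have proj j : (j <= r)%N -> is_proj (@conj_fun R (chart_plane i)) (pi j).
  by move=> jr; rewrite piE //; apply: lift_proj (sub_gauss jr).
have harm0 : harmonic_proj del (@delbar R (chart_plane i)) (pi 0%N).
  by rewrite piE //; apply: harmonic_lift harm.
have gim j : (j < r)%N -> gauss_image del (pi j) (pi j.+1).
  move=> jr; rewrite !piE ?(ltnW jr) //.
  by apply: fills_gauss_image; [exact: sub_gauss (ltnW jr) | exact: gauss_fills iso jr].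
have orth j : (0 < j <= r)%N -> pi 0%N *m pi j = 0.
  move=> /andP[j0 jr]; rewrite !piE //; apply: chart_mx_eq => [y iy|w Vw].
    rewrite map_mxM !eval_lift ?map_mx0 //; last first.
    - exact: subbundle_smooth phi_sub.
    - exact: subbundle_smooth (sub_gauss jr).
    by case: iso => _ /(_ j) + _; apply; rewrite j0.
  by rewrite map_mxM eval_lift0 // mul0mx map_mx0.
(* The image of [c] lies in [alpha]. For [t = 0] the claim holds because [alpha] lies in the kernel
   of [c], and for [t >= 1] because [D_t] vanishes on [alpha]. *)
have ret0 t : (t < s)%N -> return1 del r pi *m return2 del r pi ^+ t *m return1 del r pi = 0.
  move=> ts; apply: chart_mx_eq => [y iy|w Vw]; last first.
    have ch0 j : (j <= r)%N -> ev w (del_chain del pi j) = 0.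
      elim: j => [|j IH] jr /=; first by rewrite piE // eval_lift0.
      by rewrite map_mxM IH ?mulmx0 // ltnW.
    have ret1 : ev w (return1 del r pi) = 0 by rewrite /return1 map_mxM ch0 // mulmx0.
    by rewrite map_mx0 map_mxM ret1 mulmx0.
  rewrite 2!map_mxM ev_exp ev_return1 // ev_return2 // map_mx0.
  apply: mulmx_cols_eq => v; rewrite mul0mx.
  have cphi : first_return phi r i y *m phi y = first_return phi r i y.
    by rewrite /first_return -mulmxA chain_phi.
  have cv : space (alpha y) (first_return phi r i y *m v).
    apply: (im_c y iy); exists (phi y *m v); first by rewrite /space /= mulmxA subbundle_idem.
    by rewrite mulmxA cphi.
  rewrite -mulmxA; case: t ts => [|t] ts.
    by rewrite expr0 mulmx1; exact: (ker_c y iy _ cv).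
  by have := Dt0 t.+1 ts i y iy _ cv; rewrite expr1.
have [p Hp] := return_nilpotent (@delM R (chart_plane i)) (@delbarM R (chart_plane i))
  (@conj_del R (chart_plane i)) (@conj_delbar R (chart_plane i)) (@del_delbar R (chart_plane i))
  r1 proj harm0 gim orth pi_last (uniton_A0 i al) (uniton_AS i al)
  (fun j jN => uniton_lift_conditions alU jN (uniton_liftP i phi0U alU (ltnW jN))) AN ret0.
exists p; rewrite /return_D -ev_return1 // -ev_return2 // -ev_exp -map_mxM -ev_exp Hp.
exact: map_mx0.
Qed.

End ReturnMapsInChart.

Unset Implicit Arguments.

Theorem proposition2p14 (R : realType) (M : riemann_surface R) (n k r : nat)
    (phi alpha : M -> 'M[R[i]]_n) (s : nat) :
  connected [set: M] ->
  harmonic_grassmannian k phi ->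
  finite_uniton_number phi ->
  finite_isotropy_order phi r ->
  nilorder_on phi (first_return phi r) 2 ->
  subbundle alpha ->
  (forall x, space (alpha x) `<=` space (phi x)) ->
  (forall (i : rs_index M) x, cdom i x ->
    mulmx (first_return phi r i x) @` space (phi x) `<=` space (alpha x)) ->
  (forall (i : rs_index M) x, cdom i x ->
    space (alpha x) `<=` [set v | first_return phi r i x *m v = 0]) ->
  (1 <= s)%N ->
  (forall t, (1 <= t < s)%N -> power_zero_on alpha (return_D phi r t) 1) ->
  nilpotent_on alpha (return_D phi r s).
Proof.
(* The exponent found at a point may depend on the point and the chart; the size [n] of the matrices
   serves for all of them. *)
move=> _ harm fun_phi iso _ _ _ im_c ker_c _ Dt0; exists n => i x ix v _.
have [p Dp] := return_D_nilpotent_at harm iso fun_phi (im_c i) (ker_c i) Dt0 ix.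
by rewrite (nilpotent_mx_dim Dp) mul0mx.
Qed.
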